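(* Let $[I,\mathbf c]$ be a cycloribbon of size $n$ with colors in $\{1,\dots,r\}$, let $\eta_I\in H_n(0)\subseteq \mathcal H_{n,r}(0)$ be as in the context, and put $\eta_{[I,\mathbf c]}:=L_{\mathbf c}\,\eta_I$. Then $S_{[I,\mathbf c]}:=\mathcal H_{n,r}(0)\,\eta_{[I,\mathbf c]}$ is a simple $\mathcal H_{n,r}(0)$-module, realized as a minimal left ideal of the left regular representation. It is one-dimensional; $L_{\mathbf d}$ acts on it by $1$ if $\mathbf d=\mathbf c$ and by $0$ otherwise; and $T_i$ acts by $-1$ if $i\in D(J)$ and by $0$ otherwise, where $[J,\mathbf c]=\phi([I,\mathbf c])$. The modules $S_{[I,\mathbf c]}$ attached to distinct cycloribbons are pairwise non-isomorphic, and every one-dimensional $\mathcal H_{n,r}(0)$-module is isomorphic to some $S_{[I,\mathbf c]}$.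
   Context: Fix integers $n,r\ge1$ and distinct complex numbers $u_1,\dots,u_r$; let $P_k(X)=\prod_{l\ne k}\frac{X-u_l}{u_k-u_l}$. The $0$-Ariki-Koike-Shoji algebra $\mathcal H_{n,r}(0)$ is the unital associative $\mathbb C$-algebra with generators $T_1,\dots,T_{n-1},\xi_1,\dots,\xi_n$ and relations: $T_i(T_i+1)=0$; $T_iT_{i+1}T_i=T_{i+1}T_iT_{i+1}$; $T_iT_j=T_jT_i$ for $|i-j|\ge2$; $\prod_{k=1}^r(\xi_j-u_k)=0$; $\xi_i\xi_j=\xi_j\xi_i$; $T_i\xi_i=\xi_{i+1}T_i+\sum_{1\le a<b\le r}(u_b-u_a)P_a(\xi_i)P_b(\xi_{i+1})$; $T_i(\xi_i+\xi_{i+1})=(\xi_i+\xi_{i+1})T_i$; $T_i\xi_j=\xi_jT_i$ for $j\notin\{i,i+1\}$. The subalgebra generated by the $T_i$ is the $0$-Hecke algebra $H_n(0)$. A color word is $\mathbf c=(c_1,\dots,c_n)\in\{1,\dots,r\}^n$, and $L_{\mathbf c}:=P_{c_1}(\xi_1)\cdots P_{c_n}(\xi_n)$. For a composition $I=(i_1,\dots,i_m)$ of $n$, $D(I)=\{i_1,i_1+i_2,\dots,i_1+\dots+i_{m-1}\}$. A pair $[I,\mathbf c]$ ($I$ a composition of $n$, $\mathbf c$ a color word of length $n$) is a cycloribbon if for all $1\le i\le n-1$: $i\in D(I)\Rightarrow c_i\ge c_{i+1}$ and $i\notin D(I)\Rightarrow c_i\le c_{i+1}$; it is an anticycloribbon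 if $i\in D(I)\Rightarrow c_i\le c_{i+1}$ and $i\notin D(I)\Rightarrow c_i\ge c_{i+1}$. The involution $\phi$ sends $[I,\mathbf c]$ to $[J,\mathbf c]$ where $D(J)=\{i\in D(I): c_i=c_{i+1}\}\cup\{i\notin D(I): c_i\ne c_{i+1}\}$; it exchanges cycloribbons and anticycloribbons. For a composition $I$ of $n$, $\eta_I$ denotes a nonzero element of $H_n(0)$ with $-T_i\eta_I=\eta_I$ for $i\in D(I)$ and $(1+T_i)\eta_I=\eta_I$ for $i\notin D(I)$ (a generator of the simple $H_n(0)$-module labelled by $I$ in the left regular representation). *)

(* Defs.v *)
From HB Require Import structures.
From mathcomp Require Import all_boot all_order all_algebra.
From mathcomp Require Import generic_quotient.
From mathcomp Require Import boolp.
From mathcomp Require Import reals complex.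
From mathcomp Require Import monalg.

Set Implicit Arguments.
Unset Strict Implicit.
Unset Printing Implicit Defensive.

Import GRing.Theory.

Local Open Scope ring_scope.
Local Open Scope quotient_scope.

(* Indices are 0-based: the sizes "n" and "r" of the mathematics are written
   n.+1 and r.+1 here, the generators T_1, ..., T_n of size n.+1 are indexed by
   i : 'I_n (so i stands for the position i.+1), and xi_1, ..., xi_{n+1} and
   the letters of color words by j : 'I_n.+1; colors are the elements of
   'I_r.+1 with their natural order. *)

Section FreeAlgebra.
Variables (F : fieldType) (G : choiceType).

Definition freealg : Type := {malg F[{fmonom G}]}.
HB.instance Definition _ := GRing.Lalgebra.on freealg.

Fact freealg_scalerAr (c : F) (x y : freealg) : c *: (x * y) = x * (c *: y).
Proof.
suff cC (g : {malg F[{fmonom G}]}) : malgC c * g = g * malgC c.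
  by rewrite -!mul_malgC mulrA cC mulrA.
apply/malgP=> k; rewrite /malgC !malgM_def fgmulUg fgmulgU.
by congr (mcoeff _ _); apply: eq_bigr => k' _; rewrite mul1m mulm1 mulrC.
Qed.
HB.instance Definition _ :=
  GRing.Lalgebra_isAlgebra.Build F freealg freealg_scalerAr.

Definition freegen (g : G) : freealg := mkmalgU (fmu g) 1.

Section Eval.
Variables (B : algType F) (h : G -> B).

Definition evalmon (m : {fmonom G}) : B := \prod_(g <- fmonom_val m) h g.

Fact evalmon_morph : mmorphism evalmon.
Proof.
split=> [x y|]; rewrite /evalmon; last by rewrite fm1 big_nil.
by rewrite fmM big_cat.
Qed.
HB.instance Definition _ := isMultiplicative.Build _ B evalmon evalmon_morph.

Definition freeeval (x : freealg) : B := mmap (in_alg B) evalmon x.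

Fact freeeval_is_additive : additive freeeval.
Proof. exact: mmap_is_additive. Qed.
HB.instance Definition _ :=
  GRing.isZmodMorphism.Build freealg B freeeval freeeval_is_additive.

Fact freeeval_is_multiplicative : multiplicative freeeval.
Proof.
by apply: commr_mmap_is_multiplicative => g m m'; rewrite /GRing.comm comm_alg.
Qed.
HB.instance Definition _ :=
  GRing.isMultiplicative.Build freealg B freeeval freeeval_is_multiplicative.

Fact freeeval_is_scalable : scalable freeeval.
Proof. by move=> c x; rewrite /freeeval mmapZ /= mulr_algl. Qed.
HB.instance Definition _ :=
  GRing.isScalable.Build F freealg B *:%R freeeval freeeval_is_scalable.

Lemma freeeval_gen g : freeeval (freegen g) = h g.
Proof.
by rewrite /freeeval mmapU /= scale1r mul1r /evalmon fmU big_seq1.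
Qed.

Lemma freeeval_uniq (f : {lrmorphism freealg -> B}) :
  (forall g, f (freegen g) = h g) -> f =1 freeeval.
Proof.
move=> fg x; rewrite /freeeval mmapE [x in LHS]monalgE raddf_sum.
apply: eq_bigr => m _ /=; rewrite mulr_algl.
have -> : mkmalgU m x@_m = x@_m *: (mkmalgU m 1 : freealg).
  by apply/malgP => k; rewrite mcoeffZ !mcoeffU mulrnAr mulr1.
rewrite linearZ; congr (_ *: _).
rewrite /evalmon; case: m => s /=; elim: s => [|g s IHs].
  by rewrite big_nil -[RHS](rmorph1 f); congr (f _); rewrite -fmoneE.
rewrite big_cons -fg -IHs -rmorphM; congr (f _).
rewrite /freegen [RHS]fgmulUU mulr1; congr (mkmalgU _ _).
by apply/val_inj; rewrite /= fmM fmU.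
Qed.

End Eval.
End FreeAlgebra.

Section Quotient.
Variables (F : fieldType) (A : algType F) (X : A -> Prop).

(* The two-sided ideal generated by X. *)
Inductive ideal_gen : A -> Prop :=
| ideal_gen0 : ideal_gen 0
| ideal_genD a x b y : X x -> ideal_gen y -> ideal_gen (a * x * b + y).

Lemma ideal_gen_add x y : ideal_gen x -> ideal_gen y -> ideal_gen (x + y).
Proof.
move=> Ix Iy; elim: Ix => [|a z b w Xz _ IH]; first by rewrite add0r.
by rewrite -addrA; apply: ideal_genD.
Qed.

Lemma ideal_gen_mul a x b : ideal_gen x -> ideal_gen (a * x * b).
Proof.
elim=> [|c z d w Xz _ IH]; first by rewrite mulr0 mul0r; apply: ideal_gen0.
by rewrite mulrDr mulrDl !mulrA -(mulrA _ d b); apply: ideal_genD.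
Qed.

Lemma ideal_gen_opp x : ideal_gen x -> ideal_gen (- x).
Proof. by move/(ideal_gen_mul (-1) 1); rewrite mulr1 mulN1r. Qed.

Lemma ideal_gen_scale (c : F) x : ideal_gen x -> ideal_gen (c *: x).
Proof. by move/(ideal_gen_mul c%:A 1); rewrite mulr1 mulr_algl. Qed.

Lemma ideal_gen_sub x : X x -> ideal_gen x.
Proof.
move=> Xx; have -> : x = 1 * x * 1 + 0 by rewrite mul1r mulr1 addr0.
by apply: ideal_genD => //; apply: ideal_gen0.
Qed.

Definition ideal_rel : rel A := fun x y => `[< ideal_gen (x - y) >].

Fact ideal_rel_equiv : equiv_class_of ideal_rel.
Proof.
split=> [x|x y|y x z].
- by apply/asboolP; rewrite subrr; apply: ideal_gen0.
- by apply/asboolP/asboolP => /ideal_gen_opp; rewrite opprB.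
- move=> /asboolP xy /asboolP yz; apply/asboolP.
  by rewrite -[x](subrK y) -addrA; apply: ideal_gen_add.
Qed.
Canonical ideal_rel_canonical := EquivRelPack ideal_rel_equiv.

Definition quotalg : Type := {eq_quot ideal_rel}.
HB.instance Definition _ := Choice.on quotalg.
HB.instance Definition _ := EqQuotient.on quotalg.

Lemma quotP (x y : A) : ideal_gen (x - y) <-> \pi_quotalg x = \pi_quotalg y.
Proof.
split=> [Ixy|/eqP]; first by apply/eqP; rewrite piE; apply/asboolP.
by rewrite piE => /asboolP.
Qed.

Lemma repr_quot (x : A) : ideal_gen (repr (\pi_quotalg x) - x).
Proof. by apply/quotP; rewrite reprK. Qed.

Definition quot_add (p q : quotalg) : quotalg := \pi_quotalg (repr p + repr q).
Definition quot_opp (p : quotalg) : quotalg := \pi_quotalg (- repr p).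
Definition quot_mul (p q : quotalg) : quotalg := \pi_quotalg (repr p * repr q).
Definition quot_scale (c : F) (p : quotalg) : quotalg := \pi_quotalg (c *: repr p).

Lemma quot_addE x y : quot_add (\pi_quotalg x) (\pi_quotalg y) = \pi_quotalg (x + y).
Proof.
by apply/quotP; rewrite opprD addrACA; apply: ideal_gen_add; apply: repr_quot.
Qed.

Lemma quot_oppE x : quot_opp (\pi_quotalg x) = \pi_quotalg (- x).
Proof. by apply/quotP; rewrite -opprD; apply/ideal_gen_opp/repr_quot. Qed.

Lemma quot_mulE x y : quot_mul (\pi_quotalg x) (\pi_quotalg y) = \pi_quotalg (x * y).
Proof.
apply/quotP; set x' := repr _; set y' := repr _.
have -> : x' * y' - x * y = 1 * (x' - x) * y' + x * (y' - y) * 1.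
  by rewrite mul1r mulr1 mulrBl mulrBr addrA subrK.
by apply: ideal_gen_add; apply/ideal_gen_mul/repr_quot.
Qed.

Lemma quot_scaleE c x : quot_scale c (\pi_quotalg x) = \pi_quotalg (c *: x).
Proof. by apply/quotP; rewrite -scalerBr; apply/ideal_gen_scale/repr_quot. Qed.


Fact quot_addA : associative quot_add.
Proof.
elim/quotW=> x; elim/quotW=> y; elim/quotW=> z.
by rewrite (quot_addE x y) (quot_addE y z) (quot_addE x) (quot_addE _ z) addrA.
Qed.
Fact quot_addC : commutative quot_add.
Proof. by elim/quotW=> x; elim/quotW=> y; rewrite (quot_addE x) (quot_addE y) addrC. Qed.
Fact quot_add0 : left_id (\pi_quotalg 0) quot_add.
Proof. by elim/quotW=> x; rewrite (quot_addE 0 x) add0r. Qed.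
Fact quot_addN : left_inverse (\pi_quotalg 0) quot_opp quot_add.
Proof. by elim/quotW=> x; rewrite (quot_oppE x) (quot_addE _ x) addNr. Qed.
HB.instance Definition _ := GRing.isZmodule.Build quotalg
  quot_addA quot_addC quot_add0 quot_addN.

Fact quot_mulA : associative quot_mul.
Proof.
elim/quotW=> x; elim/quotW=> y; elim/quotW=> z.
by rewrite (quot_mulE x y) (quot_mulE y z) (quot_mulE x) (quot_mulE _ z) mulrA.
Qed.
Fact quot_mul1 : left_id (\pi_quotalg 1) quot_mul.
Proof. by elim/quotW=> x; rewrite (quot_mulE 1 x) mul1r. Qed.
Fact quot_mulr1 : right_id (\pi_quotalg 1) quot_mul.
Proof. by elim/quotW=> x; rewrite (quot_mulE x 1) mulr1. Qed.
Fact quot_mulDl : left_distributive quot_mul quot_add.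
Proof.
elim/quotW=> x; elim/quotW=> y; elim/quotW=> z; rewrite (quot_addE x y).
by rewrite (quot_mulE _ z) (quot_mulE x z) (quot_mulE y z) quot_addE mulrDl.
Qed.
Fact quot_mulDr : right_distributive quot_mul quot_add.
Proof.
elim/quotW=> x; elim/quotW=> y; elim/quotW=> z; rewrite (quot_addE y z).
by rewrite (quot_mulE x) (quot_mulE x z) (quot_mulE x y) quot_addE mulrDr.
Qed.
HB.instance Definition _ := GRing.Zmodule_isPzRing.Build quotalg
  quot_mulA quot_mul1 quot_mulr1 quot_mulDl quot_mulDr.

Fact quot_scaleA a b (v : quotalg) :
  quot_scale a (quot_scale b v) = quot_scale (a * b) v.
Proof.
by elim/quotW: v => x; rewrite (quot_scaleE b x) (quot_scaleE (a * b) x)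
  quot_scaleE scalerA.
Qed.
Fact quot_scale1 : left_id 1 quot_scale.
Proof. by elim/quotW=> x; rewrite (quot_scaleE 1 x) scale1r. Qed.
Fact quot_scaleDr : right_distributive quot_scale +%R.
Proof.
move=> c; elim/quotW=> x; elim/quotW=> y; rewrite [X in quot_scale c X]quot_addE.
by rewrite (quot_scaleE c x) (quot_scaleE c y) [RHS]quot_addE quot_scaleE scalerDr.
Qed.
Fact quot_scaleDl (v : quotalg) : {morph quot_scale^~ v : a b / a + b}.
Proof.
elim/quotW: v => x a b; rewrite (quot_scaleE a x) (quot_scaleE b x).
by rewrite (quot_scaleE _ x) [RHS]quot_addE scalerDl.
Qed.
HB.instance Definition _ := GRing.Zmodule_isLmodule.Build F quotalg
  quot_scaleA quot_scale1 quot_scaleDr quot_scaleDl.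

Definition quotproj (x : A) : quotalg := \pi_quotalg x.

Fact quotproj_is_additive : additive quotproj.
Proof.
move=> x y; apply/esym.
exact: etrans (congr1 (quot_add _) (quot_oppE y)) (quot_addE x (- y)).
Qed.
HB.instance Definition _ :=
  GRing.isZmodMorphism.Build A quotalg quotproj quotproj_is_additive.
Fact quotproj_is_multiplicative : multiplicative quotproj.
Proof. by split=> // x y; apply/esym/quot_mulE. Qed.
HB.instance Definition _ :=
  GRing.isMultiplicative.Build A quotalg quotproj quotproj_is_multiplicative.
Fact quotproj_is_scalable : scalable quotproj.
Proof. by move=> c x; apply/esym/quot_scaleE. Qed.
HB.instance Definition _ :=
  GRing.isScalable.Build F A quotalg *:%R quotproj quotproj_is_scalable.

Lemma quotproj_eq0 x : quotproj x = 0 <-> ideal_gen x.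
Proof. by rewrite -[x in ideal_gen x]subr0 quotP. Qed.

Lemma quotproj_surj (v : quotalg) : exists x, v = quotproj x.
Proof. by elim/quotW: v => x; exists x. Qed.

Fact quot_scaleAl c (v w : quotalg) : c *: (v * w) = (c *: v) * w.
Proof.
have [[x ->] [y ->]] := (quotproj_surj v, quotproj_surj w).
by rewrite -linearZ -!rmorphM -linearZ scalerAl.
Qed.
Fact quot_scaleAr c (v w : quotalg) : c *: (v * w) = v * (c *: w).
Proof.
have [[x ->] [y ->]] := (quotproj_surj v, quotproj_surj w).
by rewrite -linearZ -!rmorphM -linearZ scalerAr.
Qed.

End Quotient.

Section Lagrange.
Variables (F : fieldType) (r : nat) (u : 'I_r.+1 -> F).

Definition lagrangeP (k : 'I_r.+1) : {poly F} :=
  \prod_(l < r.+1 | l != k) ((u k - u l)^-1 *: ('X - (u l)%:P)).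

End Lagrange.

Section Presentation.
Variables (F : fieldType) (n r : nat) (u : 'I_r.+1 -> F).

Definition lo (i : 'I_n) : 'I_n.+1 := widen_ord (leqnSn n) i.
Definition hi (i : 'I_n) : 'I_n.+1 := lift ord0 i.

Inductive AKS_relation (A : algType F) (T : 'I_n -> A) (xi : 'I_n.+1 -> A) :
    A -> A -> Prop :=
| rel_quad i : AKS_relation T xi (T i * (T i + 1)) 0
| rel_braid (i j : 'I_n) : (j = i.+1 :> nat) ->
    AKS_relation T xi (T i * T j * T i) (T j * T i * T j)
| rel_comm (i j : 'I_n) : (i.+1 < j)%N || (j.+1 < i)%N ->
    AKS_relation T xi (T i * T j) (T j * T i)
| rel_min j : AKS_relation T xi (\prod_(k < r.+1) (xi j - (u k)%:A)) 0
| rel_xi i j : AKS_relation T xi (xi i * xi j) (xi j * xi i)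
| rel_mixed i : AKS_relation T xi (T i * xi (lo i))
    (xi (hi i) * T i +
     \sum_(a < r.+1) \sum_(b < r.+1 | (a < b)%N)
       (u b - u a) *: (horner_alg (xi (lo i)) (lagrangeP u a) *
                       horner_alg (xi (hi i)) (lagrangeP u b)))
| rel_sum i : AKS_relation T xi (T i * (xi (lo i) + xi (hi i)))
                                ((xi (lo i) + xi (hi i)) * T i)
| rel_far i j : j != lo i -> j != hi i ->
    AKS_relation T xi (T i * xi j) (xi j * T i).

Lemma horner_alg_lrmorph (A B : algType F) (f : {lrmorphism A -> B}) x p :
  f (horner_alg x p) = horner_alg (f x) p.
Proof.
elim/poly_ind: p => [|p c IHp]; first by rewrite !raddf0.
by rewrite !rmorphD !rmorphM /= IHp !horner_algX !horner_algC rmorph_alg.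
Qed.

Lemma AKS_relation_map (A B : algType F) (f : {lrmorphism A -> B}) T xi a b :
  AKS_relation T xi a b -> AKS_relation (f \o T) (f \o xi) (f a) (f b).
Proof.
case=> [i|i j ij|i j ij|j|i j|i|i|i j ji ji'].
- by rewrite rmorphM rmorphD rmorph1 rmorph0; apply: (rel_quad (f \o T)).
- by rewrite !rmorphM; apply: (@rel_braid _ (f \o T)).
- by rewrite !rmorphM; apply: (@rel_comm _ (f \o T)).
- rewrite rmorph_prod rmorph0 /=.
  under eq_bigr do rewrite rmorphB /= rmorph_alg.
  exact: (@rel_min _ (f \o T) (f \o xi)).
- by rewrite !rmorphM; apply: (@rel_xi _ (f \o T) (f \o xi)).
- rewrite rmorphD !rmorphM raddf_sum /=.
  under eq_bigr => a' _.
    rewrite raddf_sum /=.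
    under eq_bigr => b' _ do rewrite linearZ rmorphM /= !horner_alg_lrmorph.
    over.
  exact: (@rel_mixed _ (f \o T) (f \o xi)).
- by rewrite !rmorphM !rmorphD; apply: (@rel_sum _ (f \o T) (f \o xi)).
- by rewrite !rmorphM; apply: (@rel_far _ (f \o T) (f \o xi)).
Qed.

Lemma AKS_relation_lift (A B : algType F) (f : {lrmorphism A -> B}) T xi a b :
    AKS_relation (f \o T) (f \o xi) a b ->
  exists a' b', [/\ AKS_relation T xi a' b', a = f a' & b = f b'].
Proof.
case=> [i|i j ij|i j ij|j|i j|i|i|i j ji ji'] /=.
- do 2!eexists; split; [exact: rel_quad|by rewrite rmorphM rmorphD rmorph1|].
  by rewrite rmorph0.
- by do 2!eexists; split; [exact: (@rel_braid _ T xi i j)|rewrite !rmorphM..].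
- by do 2!eexists; split; [exact: (@rel_comm _ T xi i j)|rewrite !rmorphM..].
- do 2!eexists; split; [exact: (@rel_min _ T xi j)| |by rewrite rmorph0].
  by rewrite rmorph_prod; apply: eq_bigr => k _; rewrite rmorphB /= rmorph_alg.
- by do 2!eexists; split; [exact: (@rel_xi _ T xi i j)|rewrite !rmorphM..].
- do 2!eexists; split; [exact: (@rel_mixed _ T xi i)|by rewrite !rmorphM|].
  rewrite rmorphD !rmorphM raddf_sum /=; congr (_ + _); apply: eq_bigr => a' _.
  rewrite raddf_sum /=; apply: eq_bigr => b' _.
  by rewrite linearZ rmorphM /= !horner_alg_lrmorph.
- by do 2!eexists; split; [exact: (@rel_sum _ T xi i)|rewrite !rmorphM rmorphD..].
- by do 2!eexists; split; [exact: (@rel_far _ T xi i j)|rewrite !rmorphM..].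
Qed.

Definition AKS_gens : Type := ('I_n + 'I_n.+1)%type.
HB.instance Definition _ := Finite.on AKS_gens.

Definition free_T (i : 'I_n) : freealg F AKS_gens :=
  freegen F (inl i : AKS_gens).
Definition free_xi (j : 'I_n.+1) : freealg F AKS_gens :=
  freegen F (inr j : AKS_gens).

Definition AKS_relator (x : freealg F AKS_gens) : Prop :=
  exists a b, AKS_relation free_T free_xi a b /\ x = a - b.

Definition AKS : Type := quotalg AKS_relator.
HB.instance Definition _ := GRing.PzRing.on AKS.
HB.instance Definition _ := GRing.Lmodule.on AKS.

Definition gens_fun (B : Type) (T : 'I_n -> B) (xi : 'I_n.+1 -> B)
  (g : AKS_gens) : B := match g with inl i => T i | inr j => xi j end.

Lemma ideal_gen_eval (B : algType F) (T : 'I_n -> B) (xi : 'I_n.+1 -> B) x :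
    (forall a b, AKS_relation T xi a b -> a = b) ->
  ideal_gen AKS_relator x -> freeeval (gens_fun T xi) x = 0.
Proof.
move=> Trel; elim=> [|a y b z [p [q [pq ->]]] _ IH]; first by rewrite raddf0.
rewrite raddfD /= {}IH addr0 !rmorphM rmorphB /=.
have {}pq := AKS_relation_map (freeeval (gens_fun T xi)) pq.
have eT : freeeval (gens_fun T xi) \o free_T = T.
  by apply/funext => i; rewrite /= freeeval_gen.
have exi : freeeval (gens_fun T xi) \o free_xi = xi.
  by apply/funext => i; rewrite /= freeeval_gen.
move: pq; rewrite eT exi => /Trel ->.
by rewrite subrr mulr0 mul0r.
Qed.

Lemma lagrangeP_ord0 (k : 'I_r.+1) :
  k != ord0 -> (lagrangeP u k).[u ord0] = 0.
Proof.
move=> k0; rewrite /lagrangeP (bigD1 ord0) 1?eq_sym //= hornerM hornerZ.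
by rewrite hornerXsubC subrr mulr0 mul0r.
Qed.

Lemma horner_alg_reg (x : F^o) (p : {poly F}) : horner_alg x p = p.[x].
Proof.
elim/poly_ind: p => [|p c IHp]; first by rewrite raddf0 horner0.
rewrite rmorphD rmorphM /= IHp horner_algX horner_algC hornerMXaddC.
by rewrite [c%:A]mulr1.
Qed.

(* The algebra is nonzero: T_i |-> 0, xi_j |-> u_0 is a character of it. *)
Fact AKS_oner_neq0 : (1 : AKS) != 0.
Proof.
apply/eqP => /(proj1 (quotproj_eq0 _ _)).
move/(@ideal_gen_eval F^o (fun=> 0) (fun=> u ord0)); rewrite rmorph1 => H.
suff /H/eqP : forall a b : F^o,
    @AKS_relation F^o (fun=> 0) (fun=> u ord0) a b -> a = b by rewrite oner_eq0.
move=> _ _ [i|i j ij|i j ij|j|i j|i|i|i j ji ji'] //=.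
- by rewrite mul0r.
- by rewrite big_ord_recl [_%:A]mulr1 subrr mul0r.
- rewrite mul0r mulr0 add0r big1 // => a _; rewrite big1 // => b ab.
  rewrite !horner_alg_reg (lagrangeP_ord0 (k := b)) ?mulr0 ?scaler0 //.
  by rewrite -val_eqE /= -lt0n (leq_ltn_trans _ ab).
- by rewrite mul0r mulr0.
- by rewrite mul0r mulr0.
Qed.
HB.instance Definition _ := GRing.PzSemiRing_isNonZero.Build AKS AKS_oner_neq0.
HB.instance Definition _ :=
  GRing.Lmodule_isLalgebra.Build F AKS (@quot_scaleAl _ _ AKS_relator).
HB.instance Definition _ :=
  GRing.Lalgebra_isAlgebra.Build F AKS (@quot_scaleAr _ _ AKS_relator).

Definition AKSproj (x : freealg F AKS_gens) : AKS := quotproj AKS_relator x.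
HB.instance Definition _ := GRing.isZmodMorphism.Build (freealg F AKS_gens) AKS
  AKSproj (quotproj_is_additive AKS_relator).
HB.instance Definition _ := GRing.isMultiplicative.Build (freealg F AKS_gens) AKS
  AKSproj (quotproj_is_multiplicative AKS_relator).
HB.instance Definition _ := GRing.isScalable.Build F (freealg F AKS_gens) AKS *:%R
  AKSproj (quotproj_is_scalable AKS_relator).

Definition genT (i : 'I_n) : AKS := AKSproj (free_T i).
Definition genxi (j : 'I_n.+1) : AKS := AKSproj (free_xi j).

Lemma AKS_relations a b : AKS_relation genT genxi a b -> a = b.
Proof.
move=> /(AKS_relation_lift (f := AKSproj)) [a' [b' [ab -> ->]]].
apply/eqP; rewrite -subr_eq0 -raddfB /=; apply/eqP/quotproj_eq0.
by apply: ideal_gen_sub; exists a', b'.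
Qed.

Section Universal.
Variables (B : algType F) (T : 'I_n -> B) (xi : 'I_n.+1 -> B).
Hypothesis Trel : forall a b, AKS_relation T xi a b -> a = b.

Definition AKSlift_for of (forall a b, AKS_relation T xi a b -> a = b) :
  AKS -> B := fun x => freeeval (gens_fun T xi) (repr (x : quotalg AKS_relator)).
Let AKSlift := AKSlift_for Trel.

Fact AKSlift_proj x : AKSlift (AKSproj x) = freeeval (gens_fun T xi) x.
Proof.
apply/eqP; rewrite -subr_eq0 -raddfB /=; apply/eqP/(ideal_gen_eval Trel).
exact: repr_quot.
Qed.

Fact AKSlift_is_additive : additive AKSlift.
Proof.
move=> x y; have [[a ->] [b ->]] := (quotproj_surj x, quotproj_surj y).
by rewrite -[_ - _](raddfB AKSproj) /= !AKSlift_proj raddfB.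
Qed.
Fact AKSlift_is_multiplicative : multiplicative AKSlift.
Proof.
split=> [x y|]; last by rewrite -(rmorph1 AKSproj) AKSlift_proj rmorph1.
have [[a ->] [b ->]] := (quotproj_surj x, quotproj_surj y).
by rewrite -[_ * _](rmorphM AKSproj) /= !AKSlift_proj rmorphM.
Qed.
Fact AKSlift_is_scalable : scalable AKSlift.
Proof.
move=> c x; have [a ->] := quotproj_surj x.
by rewrite -[_ *: _](linearZZ AKSproj) /= !AKSlift_proj linearZ.
Qed.
HB.instance Definition _ := GRing.isZmodMorphism.Build AKS B
  (AKSlift_for Trel) AKSlift_is_additive.
HB.instance Definition _ := GRing.isMultiplicative.Build AKS B
  (AKSlift_for Trel) AKSlift_is_multiplicative.
HB.instance Definition _ := GRing.isScalable.Build F AKS B *:%R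
  (AKSlift_for Trel) AKSlift_is_scalable.

End Universal.

Lemma AKS_universal (B : algType F) (T : 'I_n -> B) (xi : 'I_n.+1 -> B) :
    (forall a b, AKS_relation T xi a b -> a = b) ->
  exists f : {lrmorphism AKS -> B},
    [/\ forall i, f (genT i) = T i, forall j, f (genxi j) = xi j &
      forall g : {lrmorphism AKS -> B},
        (forall i, g (genT i) = T i) -> (forall j, g (genxi j) = xi j) -> g =1 f].
Proof.
move=> Trel; exists (AKSlift_for Trel); split=> [i|j|g gT gxi x].
- by rewrite /= AKSlift_proj freeeval_gen.
- by rewrite /= AKSlift_proj freeeval_gen.
have [a ->] : exists a, x = AKSproj a by exact: quotproj_surj.
rewrite [RHS]AKSlift_proj.
rewrite -[LHS]/((g \o AKSproj) a).
apply: (@freeeval_uniq _ _ _ (gens_fun T xi) (g \o AKSproj)) => -[i|j] /=.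
  exact: gT.
exact: gxi.
Qed.

Definition colorword : Type := {ffun 'I_n.+1 -> 'I_r.+1}.
HB.instance Definition _ := Finite.on colorword.

Definition Lword (c : colorword) : AKS :=
  \prod_(j < n.+1) horner_alg (genxi j) (lagrangeP u (c j)).

(* H_n(0): the subalgebra generated by the T_i. *)
Definition hecke0 (x : AKS) : Prop :=
  forall S : {pred AKS}, GRing.subalg_closed S ->
    (forall i, genT i \in S) -> x \in S.

End Presentation.

Section Modules.

Definition module_iso (A : nzRingType) (M N : lmodType A) : Prop :=
  exists f : {linear M -> N}, bijective f.

Definition simple_module (A : nzRingType) (M : lmodType A) : Prop :=
  (exists v : M, v != 0) /\
  forall U : {pred M}, GRing.submod_closed U ->
    (forall v, v \in U -> v = 0) \/ (forall v, v \in U).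

(* Dimension over F of a module over an F-algebra A, F acting through c%:A. *)
Definition one_dimensional (F : fieldType) (A : algType F) (M : lmodType A) :
    Prop :=
  exists v : M, bijective (fun c : F => (c%:A : A) *: v).

Definition minimal_left_ideal (A : nzRingType) (I : {pred A^o}) : Prop :=
  [/\ GRing.submod_closed I,
      exists2 x, x \in I & x != 0 &
      forall J : {pred A^o}, GRing.submod_closed J -> {subset J <= I} ->
        (exists2 x, x \in J & x != 0) -> {subset I <= J}].

Variables (A : nzRingType) (x : A).

Definition princ : {pred A^o} := fun y => `[< exists a : A, y = a * x >].

Fact princ_submod_closed : GRing.submod_closed princ.
Proof.
split=> [|a _ _ /asboolP[b ->] /asboolP[c ->]]; apply/asboolP.
  by exists 0; rewrite mul0r.
by exists (a * b + c); rewrite mulrDl -mulrA.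
Qed.
HB.instance Definition _ :=
  GRing.isSubmodClosed.Build A A^o princ princ_submod_closed.

(* The left ideal A x as a left A-module. *)
Record princ_ideal : Type :=
  PrincIdeal { princ_val : A^o; princ_valP : princ_val \in princ }.
HB.instance Definition _ := [isSub for princ_val].
HB.instance Definition _ := [Choice of princ_ideal by <:].
HB.instance Definition _ := [SubChoice_isSubLmodule of princ_ideal by <:].

End Modules.

Section Compositions.
Variables (n r : nat).

Definition is_composition (m : nat) (I : seq nat) : bool :=
  all (fun k => 0 < k)%N I && (sumn I == m).

(* Compositions of n.+1. *)
Definition composition : Type := {I : seq nat | is_composition n.+1 I}.
HB.instance Definition _ := Choice.on composition.

(* i : 'I_n stands for the position i.+1; the proper partial sums of I are the
   sums of its first k parts, 1 <= k <= size I - 1. *)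
Definition descents (I : composition) : {set 'I_n} :=
  [set i : 'I_n | i.+1 \in
    [seq sumn (take k (val I)) | k <- iota 1 (size (val I)).-1]].

Definition cycloribbon (I : composition) (c : colorword n r) : Prop :=
  forall i : 'I_n,
    (i \in descents I -> (c (lo i) >= c (hi i))%N) /\
    (i \notin descents I -> (c (lo i) <= c (hi i))%N).

Definition seq_of_descents (D : {set 'I_n}) : seq nat :=
  pairmap (fun a b => b - a)%N 0%N (rcons [seq (val i).+1 | i <- enum D] n.+1).

Lemma sumn_take_pairmap a t k : path ltn a t -> (k <= size t)%N ->
  (sumn (take k (pairmap (fun a b => b - a) a t)) + a = nth 0 (a :: t) k)%N.
Proof.
elim: t a k => [|b t IHt] a [|k] //= /andP[ab bt] kt.
by rewrite addnC addnA subnKC 1?ltnW // addnC IHt.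
Qed.

Lemma descents_path (D : {set 'I_n}) :
  path ltn 0%N (rcons [seq (val i).+1 | i <- enum D] n.+1).
Proof.
have sD : sorted ltn [seq (val i).+1 | i <- enum D].
  rewrite sorted_map; apply: (@subseq_sorted _ _ _ _ (enum 'I_n)).
  - by move=> y x z; apply: ltn_trans.
  - by rewrite {1}/enum_mem -enumT; apply: filter_subseq.
  - by have := iota_ltn_sorted 0 n; rewrite -val_enum_ord sorted_map.
rewrite rcons_path path_min_sorted ?sD /=; last first.
  by apply/allP => _ /mapP[i _ ->].
have: last 0%N [seq (val i).+1 | i <- enum D]
        \in 0%N :: [seq (val i).+1 | i <- enum D] by exact: mem_last.
by rewrite inE => /predU1P[-> //|/mapP[i _ ->]]; rewrite ltnS ltn_ord.
Qed.

Fact seq_of_descents_comp D : is_composition n.+1 (seq_of_descents D).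
Proof.
have pD := descents_path D; apply/andP; split; last first.
  rewrite /seq_of_descents -[pairmap _ _ _]take_size size_pairmap -[sumn _]addn0.
  by rewrite sumn_take_pairmap // size_rcons /= nth_rcons ltnn eqxx.
rewrite /seq_of_descents; move: pD; move: (rcons _ _) => t; move: {1 3}0%N.
by elim: t => //= b t IHt a /andP[ab bt]; rewrite subn_gt0 ab IHt.
Qed.

Definition comp_of_descents (D : {set 'I_n}) : composition :=
  exist _ (seq_of_descents D) (seq_of_descents_comp D).

Lemma comp_of_descentsK : cancel comp_of_descents descents.
Proof.
move=> D; apply/setP => i; rewrite inE /= /seq_of_descents size_pairmap.
have pD := descents_path D; set t := rcons _ _ in pD *.
have -> : [seq sumn (take k (pairmap (fun a b => b - a)%N 0%N t)) |
    k <- iota 1 (size t).-1] = [seq (val i).+1 | i <- enum D].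
  rewrite {2}/t size_rcons /=.
  apply: (@eq_from_nth _ 0%N) => [|k]; first by rewrite size_map size_iota.
  rewrite size_map size_iota => kD; rewrite (nth_map 0%N) ?size_iota //.
  rewrite nth_iota // add1n -[sumn _]addn0 sumn_take_pairmap //; last first.
    by rewrite size_rcons ltnS ltnW.
  by rewrite /= nth_rcons kD.
rewrite (mem_map (f := fun i : 'I_n => (val i).+1)); last by move=> j k [/val_inj].
by rewrite mem_enum.
Qed.

(* phi fixes the color word: this is the J of phi([I, c]) = [J, c]. *)
Definition phi (I : composition) (c : colorword n r) : composition :=
  comp_of_descents [set i : 'I_n |
    (i \in descents I) && (c (lo i) == c (hi i)) ||
    (i \notin descents I) && (c (lo i) != c (hi i))].

End Compositions.

Section Eta.
Variables (F : fieldType) (n r : nat) (u : 'I_r.+1 -> F).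

Definition is_eta (I : composition n) (eta : AKS n u) : Prop :=
  [/\ hecke0 eta, eta != 0 &
    forall i : 'I_n,
      (i \in descents I -> - genT u i * eta = eta) /\
      (i \notin descents I -> (1 + genT u i) * eta = eta)].

Definition eta_ribbon (c : colorword n r) (eta : AKS n u) : AKS n u :=
  Lword u c * eta.

Definition Smod (c : colorword n r) (eta : AKS n u) : lmodType (AKS n u) :=
  princ_ideal (eta_ribbon c eta).

End Eta.

(* Main.v *)
(** Write [x_i = - T_i], [y_i = 1 + T_i] and let [s] exchange letters [i]
    and [i+1]. Sandwiching the mixed relations between the orthogonal idempotents
    [L_d] and [L_c], on which the [xi_j] act by scalars, gives
      [T_i L_c = L_(cs) T_i + [c_(i+1) < c_i] L_(cs) - [c_i < c_(i+1)] L_c],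
    so for a cycloribbon [L_c eta_I] is a common eigenvector with the announced
    eigenvalues; conversely the eigenvalues on a one-dimensional module are
    constrained by [L_c T_i L_c = - [c_i < c_(i+1)] L_c] for [c_i <> c_(i+1)].

    It is nonzero because the formula above defines an action on the functions
    from color words to any 0-Hecke module [V]; for [V] the left regular
    representation, [x] in [H_n(0)] sends the constant function 1 to
    the constant function [x], whose component at [c] survives [L_c].

    Eigenvectors [eta_I] exist: if [z] is [x] or [y], the product
    [Z = z_0 ... z_(m-1)] satisfies [x_(i+1) Z = Z x_i] and [z_0 Z = Z], so a
    descending product of such rows has any prescribed eigenvalues. On functions
    of words [y_i] is composition with sorting at [i], and the product moves the
    Dirac function of the reversed word to one with value 1 or -1 at the
    increasing word, since every factor has to create an inversion. *)

From HB Require Import structures.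
Require Import Defs.
From mathcomp Require Import all_boot all_order all_algebra all_fingroup.
From mathcomp Require Import reals complex monalg boolp zify.

Set Implicit Arguments.
Unset Strict Implicit.
Unset Printing Implicit Defensive.

Import GRing.Theory.
Local Open Scope ring_scope.

(** * Identities in abelian groups, by reflection *)

Inductive zexpr : Type :=
| ZVar of nat
| ZZero
| ZAdd of zexpr & zexpr
| ZOpp of zexpr.

Fixpoint zeval (V : zmodType) (env : seq V) (e : zexpr) : V :=
  match e with
  | ZVar i => env`_i
  | ZZero => 0
  | ZAdd e1 e2 => zeval env e1 + zeval env e2
  | ZOpp e1 => - zeval env e1
  end.

Fixpoint zcoef (e : zexpr) (i : nat) : int :=
  match e with
  | ZVar j => (j == i)%:Z
  | ZZero => 0
  | ZAdd e1 e2 => zcoef e1 i + zcoef e2 i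
  | ZOpp e1 => - zcoef e1 i
  end.

Lemma zevalE (V : zmodType) (env : seq V) e :
  zeval env e = \sum_(i < size env) env`_i *~ zcoef e i.
Proof.
elim: e => [j||e1 IH1 e2 IH2|e IH] /=.
- have [js|js] := ltnP j (size env); last first.
    rewrite nth_default // big1 // => i _.
    by rewrite gtn_eqF ?mulr0z // (leq_trans (ltn_ord i) js).
  rewrite (bigD1 (Ordinal js)) //= eqxx mulr1z big1 ?addr0 // => i.
  by rewrite -val_eqE /= eq_sym => /negbTE ->; rewrite mulr0z.
- by rewrite big1 // => i _; rewrite mulr0z.
- by rewrite IH1 IH2 -big_split; apply: eq_bigr => i _; rewrite mulrzDr.
- by rewrite IH -sumrN; apply: eq_bigr => i _; rewrite mulrNz.
Qed.

(** An expression is an integer combination of its atoms, so comparing coefficients suffices. The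
    comparison is a boolean computation that [zmod] closes by [isT]. *)
Lemma zeval_eq (V : zmodType) (env : seq V) e1 e2 :
    all (fun i => zcoef e1 i == zcoef e2 i) (iota 0 (size env)) ->
  zeval env e1 = zeval env e2.
Proof.
move=> /allP h; rewrite !zevalE; apply: eq_bigr => i _.
by rewrite (eqP (h (i : nat) _)) // mem_iota /=.
Qed.

Ltac zmem x env :=
  lazymatch env with
  | nil => constr:(false)
  | x :: _ => constr:(true)
  | _ :: ?e => zmem x e
  end.
Ltac zindex x env :=
  lazymatch env with
  | x :: _ => constr:(O)
  | _ :: ?e => let k := zindex x e in constr:(S k)
  end.
Ltac zatoms env e :=
  lazymatch e with
  | ?a + ?b => let env' := zatoms env a in zatoms env' b
  | - ?a => zatoms env a
  | 0 => env
  | _ => lazymatch zmem e env with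
         | true => env
         | false => constr:(e :: env)
         end
  end.
Ltac zreify env e :=
  lazymatch e with
  | ?a + ?b => let x := zreify env a in let y := zreify env b in
               constr:(ZAdd x y)
  | - ?a => let x := zreify env a in constr:(ZOpp x)
  | 0 => constr:(ZZero)
  | _ => let k := zindex e env in constr:(ZVar k)
  end.
Ltac zmod :=
  lazymatch goal with
  | |- @eq ?V ?l ?r =>
    let env0 := zatoms (@nil V) l in
    let env := zatoms env0 r in
    let el := zreify env l in
    let er := zreify env r in
    exact: (@zeval_eq _ env el er isT)
  end.

(** * The algebra of linear endomorphisms *)

Section LinearEndomorphisms.
Variables (F : fieldType) (V : lmodType F).

(* Unital algebras are nonzero, hence the index. *)
Record lendo (nzV : exists v : V, v != 0) : Type :=
  Lendo { lfun_of :> V -> V; lfun_ofP : linear lfun_of }.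

Variable nzV : exists v : V, v != 0.
Local Notation E := (lendo nzV).

Lemma lendoP (f g : E) : f =1 g -> f = g.
Proof.
case: f g => [f fP] [g gP] /= /funext fg; case: _ / fg in gP *.
by congr Lendo; apply: Prop_irrelevance.
Qed.

HB.instance Definition _ := gen_eqMixin E.
HB.instance Definition _ := gen_choiceMixin E.

Lemma lendoD (f : E) : {morph f : x y / x + y}.
Proof. by move=> x y; have := lfun_ofP f 1 x y; rewrite !scale1r. Qed.
Lemma lendo0 (f : E) : f 0 = 0.
Proof. by apply: (addrI (f 0)); rewrite -lendoD !addr0. Qed.
Lemma lendoZ (f : E) c : {morph f : x / c *: x}.
Proof. by move=> x; have := lfun_ofP f c x 0; rewrite lendo0 !addr0. Qed.

Fact lendo_zero_linear : linear (fun _ : V => 0 : V).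
Proof. by move=> c x y; rewrite scaler0 addr0. Qed.
Fact lendo_add_linear (f g : E) : linear (fun x => f x + g x).
Proof. by move=> c x y; rewrite !lfun_ofP scalerDr addrACA. Qed.
Fact lendo_opp_linear (f : E) : linear (fun x => - f x).
Proof. by move=> c x y; rewrite lfun_ofP opprD scalerN. Qed.
Fact lendo_id_linear : linear (fun x : V => x).
Proof. by []. Qed.
Fact lendo_comp_linear (f g : E) : linear (fun x => f (g x)).
Proof. by move=> c x y; rewrite !lfun_ofP. Qed.
Fact lendo_scale_linear a (f : E) : linear (fun x => a *: f x).
Proof. by move=> c x y; rewrite !lfun_ofP scalerDr !scalerA mulrC. Qed.

Definition lendo_zero : E := Lendo nzV lendo_zero_linear.
Definition lendo_add f g : E := Lendo nzV (lendo_add_linear f g).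
Definition lendo_opp f : E := Lendo nzV (lendo_opp_linear f).
Definition lendo_id : E := Lendo nzV lendo_id_linear.
Definition lendo_comp f g : E := Lendo nzV (lendo_comp_linear f g).
Definition lendo_scale a f : E := Lendo nzV (lendo_scale_linear a f).

Fact lendo_addA : associative lendo_add.
Proof. by move=> f g h; apply: lendoP => x; apply: addrA. Qed.
Fact lendo_addC : commutative lendo_add.
Proof. by move=> f g; apply: lendoP => x; apply: addrC. Qed.
Fact lendo_add0 : left_id lendo_zero lendo_add.
Proof. by move=> f; apply: lendoP => x; apply: add0r. Qed.
Fact lendo_addN : left_inverse lendo_zero lendo_opp lendo_add.
Proof. by move=> f; apply: lendoP => x; apply: addNr. Qed.
HB.instance Definition _ := GRing.isZmodule.Build E
  lendo_addA lendo_addC lendo_add0 lendo_addN.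

Fact lendo_compA : associative lendo_comp.
Proof. by move=> f g h; apply: lendoP. Qed.
Fact lendo_compf1 : left_id lendo_id lendo_comp.
Proof. by move=> f; apply: lendoP. Qed.
Fact lendo_comp1f : right_id lendo_id lendo_comp.
Proof. by move=> f; apply: lendoP. Qed.
Fact lendo_compDl : left_distributive lendo_comp lendo_add.
Proof. by move=> f g h; apply: lendoP. Qed.
Fact lendo_compDr : right_distributive lendo_comp lendo_add.
Proof. by move=> f g h; apply: lendoP => x; apply: lendoD. Qed.
Fact lendo_id_neq0 : lendo_id != 0 :> E.
Proof.
have [v v0] := nzV; apply: contraNneq v0 => /(congr1 (fun f : E => f v)) /= ->.
by rewrite eqxx.
Qed.
HB.instance Definition _ := GRing.Zmodule_isNzRing.Build E
  lendo_compA lendo_compf1 lendo_comp1f lendo_compDl lendo_compDr lendo_id_neq0.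

Fact lendo_scaleA a b (f : E) :
  lendo_scale a (lendo_scale b f) = lendo_scale (a * b) f.
Proof. by apply: lendoP => x; apply: scalerA. Qed.
Fact lendo_scale1 : left_id 1 lendo_scale.
Proof. by move=> f; apply: lendoP => x; apply: scale1r. Qed.
Fact lendo_scaleDr : right_distributive lendo_scale +%R.
Proof. by move=> a f g; apply: lendoP => x; apply: scalerDr. Qed.
Fact lendo_scaleDl (f : E) : {morph lendo_scale^~ f : a b / a + b}.
Proof. by move=> a b; apply: lendoP => x; apply: scalerDl. Qed.
HB.instance Definition _ := GRing.Zmodule_isLmodule.Build F E
  lendo_scaleA lendo_scale1 lendo_scaleDr lendo_scaleDl.

Fact lendo_scaleAl a (f g : E) : a *: (f * g) = (a *: f) * g.
Proof. exact: lendoP. Qed.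
HB.instance Definition _ := GRing.Lmodule_isLalgebra.Build F E lendo_scaleAl.
Fact lendo_scaleAr a (f g : E) : a *: (f * g) = f * (a *: g).
Proof. by apply: lendoP => x; apply/esym/lendoZ. Qed.
HB.instance Definition _ := GRing.Lalgebra_isAlgebra.Build F E lendo_scaleAr.

Lemma lendo_addE (f g : E) x : (f + g) x = f x + g x. Proof. by []. Qed.
Lemma lendo_mulE (f g : E) x : (f * g) x = f (g x). Proof. by []. Qed.
Lemma lendo_sumE (I : Type) (s : seq I) (P : pred I) (f : I -> E) x :
  (\sum_(i <- s | P i) f i) x = \sum_(i <- s | P i) f i x.
Proof.
elim: s => [|i s IHs]; first by rewrite !big_nil.
by rewrite !big_cons; case: (P i); rewrite // lendo_addE IHs.
Qed.

End LinearEndomorphisms.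

(** * Induced modules *)

Section Swaps.
Variables (n r : nat).
Implicit Types (i j : 'I_n) (d : colorword n r).

Definition swapw i d : colorword n r := [ffun k => d (tperm (lo i) (hi i) k)].

Lemma lo_neq_hi i : lo i != hi i.
Proof. by rewrite -val_eqE /= /bump leq0n add1n neq_ltn ltnSn. Qed.

Lemma swapw_lo i d : swapw i d (lo i) = d (hi i).
Proof. by rewrite ffunE tpermL. Qed.
Lemma swapw_hi i d : swapw i d (hi i) = d (lo i).
Proof. by rewrite ffunE tpermR. Qed.
Lemma swapw_far i d k : k != lo i -> k != hi i -> swapw i d k = d k.
Proof. by move=> kl kh; rewrite ffunE tpermD // eq_sym. Qed.
Lemma swapwK i : involutive (swapw i).
Proof. by move=> d; apply/ffunP => k; rewrite !ffunE tpermK. Qed.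
Lemma swapw_id i d : d (lo i) = d (hi i) -> swapw i d = d.
Proof.
by move=> e; apply/ffunP => k; rewrite ffunE; case: tpermP => [->|->|].
Qed.

Lemma hi_lo i j : j = i.+1 :> nat -> hi i = lo j.
Proof. by move=> ji; apply/val_inj; rewrite /= /bump leq0n add1n. Qed.

Lemma swapw_braid i j d : j = i.+1 :> nat ->
  swapw i (swapw j (swapw i d)) = swapw j (swapw i (swapw j d)).
Proof.
move=> ji; have e := hi_lo ji.
have hp : hi j != lo i by rewrite -val_eqE /= /bump /=; lia.
have hq : hi j != hi i by rewrite e eq_sym lo_neq_hi.
(* By conjugation both sides of the braid relation are the transposition of [lo i] and [hi j]. *)
have E (x y z : 'I_n.+1) : z != x -> z != y ->
    (tperm x y * tperm y z * tperm x y)%g = tperm x z.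
  move=> zx zy; rewrite -{1}(tpermV x y) -mulgA -conjgE tpermJ tpermR tpermD //.
    by rewrite eq_sym.
  by rewrite eq_sym.
apply/ffunP => k; rewrite !ffunE -e -!permM; congr (d (_ k)).
rewrite !mulgA E // (tpermC (hi i) (hi j)) (tpermC (lo i) (hi i)) E 1?tpermC //.
  by rewrite eq_sym.
exact: lo_neq_hi.
Qed.

Lemma far_positions i j : (i.+1 < j)%N || (j.+1 < i)%N ->
  [/\ lo j != lo i, lo j != hi i, hi j != lo i & hi j != hi i].
Proof. by rewrite -!val_eqE /= /bump /=; split; lia. Qed.

Lemma swapw_comm i j d : (i.+1 < j)%N || (j.+1 < i)%N ->
  swapw i (swapw j d) = swapw j (swapw i d).
Proof.
move=> /far_positions[h1 h2 h3 h4].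
apply/ffunP => k; rewrite !ffunE -!permM; congr (d (_ k)).
suff C : commute (tperm (lo i) (hi i)) (tperm (lo j) (hi j)) by rewrite C.
by apply/commgP/conjg_fixP; rewrite tpermJ !tpermD // eq_sym.
Qed.

End Swaps.

Section InducedModule.
Variables (F : fieldType) (n r : nat) (V : lmodType F) (t : 'I_n -> V -> V).
Hypothesis t_linear : forall i, linear (t i).
Hypothesis t_quad : forall i v, t i (t i v) = - t i v.
Hypothesis t_braid : forall (i j : 'I_n) v, j = i.+1 :> nat ->
  t i (t j (t i v)) = t j (t i (t j v)).
Hypothesis t_comm : forall (i j : 'I_n) v, (i.+1 < j)%N || (j.+1 < i)%N ->
  t i (t j v) = t j (t i v).

Local Notation W := {ffun colorword n r -> V}.
Implicit Types (i j : 'I_n) (d : colorword n r) (f : W).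

(* The action of [T_i] on [\sum_d L_d (x) f d] forced by
   [T_i L_d = L_(ds) T_i + [d_(i+1) < d_i] L_(ds) - [d_i < d_(i+1)] L_d]. *)
Definition indT i f : W :=
  [ffun d : colorword n r => t i (f (swapw i d)) +
     (if (d (lo i) < d (hi i))%N then f (swapw i d) - f d else 0)].

Lemma indTE i f d : indT i f d = t i (f (swapw i d)) +
  (if (d (lo i) < d (hi i))%N then f (swapw i d) - f d else 0).
Proof. by rewrite ffunE. Qed.

Definition indxi (x : 'I_r.+1 -> F) (k : 'I_n.+1) f : W :=
  [ffun d : colorword n r => x (d k) *: f d].

Let tD i : {morph t i : x y / x + y}.
Proof. by move=> x y; have := t_linear i 1 x y; rewrite !scale1r. Qed.
Let t0 i : t i 0 = 0.
Proof. by apply: (addrI (t i 0)); rewrite -tD !addr0. Qed.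
Let tN i : {morph t i : x / - x}.
Proof. by move=> x; apply: (addrI (t i x)); rewrite -tD !subrr t0. Qed.

Let tZ i c : {morph t i : x / c *: x}.
Proof. by move=> x; have := t_linear i c x 0; rewrite t0 !addr0. Qed.

Lemma indT_linear i : linear (indT i).
Proof.
move=> c f g; apply/ffunP => d; rewrite !ffunE t_linear.
case: ifP => _; last by rewrite !addr0.
by rewrite scalerDr scalerBr opprD [X in _ + X = _]addrACA [LHS]addrACA.
Qed.

Lemma indxi_linear x k : linear (indxi x k).
Proof.
move=> c f g; apply/ffunP => d; rewrite !ffunE scalerDr !scalerA.
by rewrite (mulrC c).
Qed.

Lemma indT_quad i f : indT i (indT i f) = - indT i f.
Proof.
apply/ffunP => d; rewrite [RHS]ffunE !indTE swapw_lo swapw_hi swapwK.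
case: (ltngtP (d (lo i)) (d (hi i))) => h.
- rewrite !(tD, tN, t0) !t_quad; zmod.
- rewrite !(tD, tN, t0) !t_quad; zmod.
- rewrite swapw_id; last exact: val_inj.
  rewrite !(tD, tN, t0) !t_quad; zmod.
Qed.

Lemma indT_comm i j f : (i.+1 < j)%N || (j.+1 < i)%N ->
  indT i (indT j f) = indT j (indT i f).
Proof.
move=> ij; have [h1 h2 h3 h4] := far_positions ij.
apply/ffunP => d; rewrite !indTE.
rewrite !(swapw_far, swapw_comm _ ij) // 1?eq_sym //.
case: ifP => _; case: ifP => _; rewrite !(tD, tN, t0) ?(t_comm _ ij); zmod.
Qed.

(** At a fixed [d] both sides combine values at the rearrangements of three letters. Once their
    order is known, [B] identifies the words, [t_quad] and [t_braid] the operators, and an identity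
    in an abelian group remains. *)
Lemma indT_braid i j f : j = i.+1 :> nat ->
  indT i (indT j (indT i f)) = indT j (indT i (indT j f)).
Proof.
move=> ij; apply/ffunP => d.
have e := hi_lo ij.
have hp : hi j != lo i by rewrite -val_eqE /= /bump /=; lia.
have hq : hi j != hi i by rewrite e eq_sym lo_neq_hi.
have lp : lo i != lo j by rewrite -e lo_neq_hi.
rewrite eq_sym in hp.
have Vi g := (swapw_lo i g, swapw_hi i g).
have Vj g : (swapw j g (hi i) = g (hi j)) * (swapw j g (hi j) = g (hi i)) *
    (swapw j g (lo i) = g (lo i)) * (swapw i g (hi j) = g (hi j)).
  by rewrite e swapw_lo swapw_hi !swapw_far // -?e // eq_sym.
have B := @swapw_braid n r i j _ ij.
rewrite !indTE -!e !(Vi, Vj) !swapwK.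
case: (ltngtP (d (lo i)) (d (hi i))) => h1;
case: (ltngtP (d (hi i)) (d (hi j))) => h2;
case: (ltngtP (d (lo i)) (d (hi j))) => h3; try by exfalso; lia.
all: try move/val_inj in h1.
all: try move/val_inj in h2.
all: try by rewrite ?B !(tD, tN, t0, t_quad, t_braid _ ij); zmod.
(* Two cases with equal neighbouring letters still need that one swap fixes [d], which identifies
   further words. *)
- have D : swapw j d = d by rewrite swapw_id -?e.
  by rewrite !B !D !(tD, tN, t0, t_quad, t_braid _ ij); zmod.
- have D : swapw i d = d by rewrite swapw_id.
  by rewrite -!B !D !(tD, tN, t0, t_quad, t_braid _ ij); zmod.
Qed.



Lemma indxi_comm x k l f : indxi x k (indxi x l f) = indxi x l (indxi x k f).
Proof. by apply/ffunP => d; rewrite !ffunE !scalerA mulrC. Qed.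

Lemma indT_indxi_far x i k f : k != lo i -> k != hi i ->
  indT i (indxi x k f) = indxi x k (indT i f).
Proof.
move=> kl kh; apply/ffunP => d; rewrite [RHS]ffunE !indTE ![indxi _ _ _ _]ffunE.
rewrite swapw_far // tZ scalerDr.
by case: ifP => _; rewrite ?scaler0 // scalerBr.
Qed.

(** For [x = u] the correction is the double sum of the mixed relation: as the [xi] act diagonally,
    only the summand [a = d (lo i)], [b = d (hi i)] survives at [d]. *)
Lemma indT_indxi_lo x i f :
  indT i (indxi x (lo i) f) = indxi x (hi i) (indT i f) +
    [ffun d : colorword n r => if (d (lo i) < d (hi i))%N
       then (x (d (hi i)) - x (d (lo i))) *: f d else 0].
Proof.
apply/ffunP => d; rewrite [RHS]ffunE [X in X + _]ffunE [X in _ + X]ffunE.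
rewrite !indTE ![indxi _ _ _ _]ffunE swapw_lo.
rewrite tZ scalerDr -addrA.
congr (_ + _); case: ifP => _; last by rewrite scaler0 addr0.
by rewrite scalerBl addrA scalerBr subrK.
Qed.

Lemma indT_indxi_hi x i f :
  indT i (indxi x (hi i) f) = indxi x (lo i) (indT i f) -
    [ffun d : colorword n r => if (d (lo i) < d (hi i))%N
       then (x (d (hi i)) - x (d (lo i))) *: f d else 0].
Proof.
apply/ffunP => d; rewrite [RHS]ffunE [X in X + _]ffunE [X in _ + X]ffunE.
rewrite [X in _ - X]ffunE.
rewrite !indTE ![indxi _ _ _ _]ffunE swapw_hi.
rewrite tZ scalerDr -addrA.
congr (_ + _); case: ifP => _; last by rewrite scaler0 subr0.
by rewrite scalerBl opprB scalerBr addrA subrK.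
Qed.

End InducedModule.

(** * Lagrange interpolation at the nodes [u k] *)

Section LagrangeTheory.
Variables (F : fieldType) (r : nat) (u : 'I_r.+1 -> F).
Hypothesis u_inj : injective u.

Lemma lagrangeP_node k l : (lagrangeP u k).[u l] = (k == l)%:R.
Proof.
rewrite /lagrangeP horner_prod; have [->|kl] := eqVneq k l.
  rewrite big1 // => m ml; rewrite hornerZ hornerXsubC mulVf //.
  by rewrite subr_eq0 (inj_eq u_inj) eq_sym.
rewrite (bigD1 l) 1?eq_sym //= hornerZ hornerXsubC subrr mulr0 mul0r //.
Qed.

(** The difference of the two sides has size at most [r.+1] and vanishes at the [r.+1] distinct
    nodes. *)
Lemma sum_lagrangeP : \sum_k lagrangeP u k = 1.
Proof.
apply/eqP; rewrite -subr_eq0; apply/negPn/negP => p0.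
have := @max_poly_roots _ _ [seq u l | l <- enum 'I_r.+1] p0.
rewrite map_inj_uniq // enum_uniq size_map size_enum_ord.
have -> : all (root (\sum_k lagrangeP u k - 1)) [seq u l | l <- enum 'I_r.+1].
  apply/allP => _ /mapP[l _ ->]; rewrite /root !hornerE horner_sum.
  rewrite (bigD1 l) //= lagrangeP_node eqxx big1 ?addr0 ?subrr // => k kl.
  by rewrite lagrangeP_node (negbTE kl).
move=> /(_ isT isT); rewrite ltnNge => /negP[].
apply: leq_trans (size_polyD _ _) _; rewrite geq_max size_polyN size_poly1
  andbT.
apply: leq_trans (size_sum _ _ _) _; apply/bigmax_leqP => k _.
have -> : lagrangeP u k = \prod_(l < r.+1 | l != k) (u k - u l)^-1 *:
    \prod_(l < r.+1 | l != k) ('X - (u l)%:P).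
  by rewrite /lagrangeP scaler_prod.
apply: leq_trans (size_scale_leq _ _) _.
by rewrite -big_filter size_prod_XsubC size_filter -sum1_count sum1_card cardC1
  card_ord.
Qed.

Lemma lagrangeP_mulXsubC k : exists a : F,
  ('X - (u k)%:P) * lagrangeP u k = a *: \prod_(l < r.+1) ('X - (u l)%:P).
Proof.
exists (\prod_(l < r.+1 | l != k) (u k - u l)^-1).
by rewrite /lagrangeP scaler_prod -scalerAr [X in _ = _ *: X](bigD1 k).
Qed.

End LagrangeTheory.

(** * Representations of the algebra built from 0-Hecke modules *)

Section Representations.
Variables (F : fieldType) (n r : nat) (u : 'I_r.+1 -> F).

Lemma horner_alg_scalar (B : algType F) (c : F) p :
  horner_alg (c%:A : B) p = p.[c]%:A.
Proof.
elim/poly_ind: p => [|p a IHp]; first by rewrite raddf0 horner0 scale0r.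
rewrite rmorphD rmorphM /= IHp horner_algX horner_algC hornerMXaddC.
by rewrite scalerDl -scalerAl mul1r scalerA.
Qed.

Lemma prod_horner_alg (B : algType F) (x : B) :
  \prod_(k < r.+1) (x - (u k)%:A) =
  horner_alg x (\prod_(k < r.+1) ('X - (u k)%:P)).
Proof.
rewrite rmorph_prod; apply: eq_bigr => k _.
by rewrite rmorphB /= horner_algX horner_algC.
Qed.

(* At [xi_j = u_0] the correction term of the mixed relation vanishes, so every
   representation of the 0-Hecke algebra extends to the whole algebra. *)
Lemma AKS_hecke_rep (B : algType F) (T : 'I_n -> B) :
    (forall i, T i * (T i + 1) = 0) ->
    (forall i j : 'I_n, j = i.+1 :> nat -> T i * T j * T i = T j * T i * T j) ->
    (forall i j : 'I_n, (i.+1 < j)%N || (j.+1 < i)%N -> T i * T j = T j * T i)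
      ->
  exists rho : {lrmorphism AKS n u -> B}, forall i, rho (genT u i) = T i.
Proof.
move=> Tquad Tbraid Tcomm.
have /AKS_universal[rho [rhoT _ _]] : forall a b,
    AKS_relation u T (fun=> (u ord0)%:A) a b -> a = b; last by exists rho.
move=> _ _ [i|i j ij|i j ij|j|i j|i|i|i j ji ji'] //=.
- exact: Tbraid.
- exact: Tcomm.
- by rewrite big_ord_recl subrr mul0r.
- rewrite comm_alg big1 ?addr0 // => a _; rewrite big1 // => b ab.
  rewrite !horner_alg_scalar (lagrangeP_ord0 u (k := b)) ?scale0r ?mulr0
    ?scaler0 //.
  by rewrite -val_eqE /= -lt0n (leq_ltn_trans _ ab).
- by rewrite mulrDl mulrDr comm_alg.
- by rewrite comm_alg.
Qed.

Hypothesis u_inj : injective u.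
Variables (V : lmodType F) (t : 'I_n -> V -> V).
Hypothesis t_linear : forall i, linear (t i).
Hypothesis t_quad : forall i v, t i (t i v) = - t i v.
Hypothesis t_braid : forall (i j : 'I_n) v, j = i.+1 :> nat ->
  t i (t j (t i v)) = t j (t i (t j v)).
Hypothesis t_comm : forall (i j : 'I_n) v, (i.+1 < j)%N || (j.+1 < i)%N ->
  t i (t j v) = t j (t i v).

Local Notation W := {ffun colorword n r -> V}.
Variable nzW : exists f : W, f != 0.

Let opT i : lendo nzW := Lendo nzW (@indT_linear _ _ r _ _ t_linear i).
Let opxi k : lendo nzW := Lendo nzW (@indxi_linear _ _ r V u k).

Lemma horner_opxi k p (f : W) d : horner_alg (opxi k) p f d = p.[u (d k)] *: f
  d.
Proof.
elim/poly_ind: p f => [|p a IHp] f.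
  by rewrite raddf0 horner0 scale0r /= ffunE.
rewrite rmorphD rmorphM /= horner_algX horner_algC hornerMXaddC.
by rewrite !ffunE IHp ffunE scalerA scalerDl.
Qed.

Lemma AKS_induced_rep : exists rho : {lrmorphism AKS n u -> lendo nzW},
  (forall i f, rho (genT u i) f = indT t i f) /\
  (forall k f, rho (genxi u k) f = indxi u k f).
Proof.
have xi_lo_mul i :
    opT i * opxi (lo i) = opxi (hi i) * opT i +
     \sum_(a < r.+1) \sum_(b < r.+1 | (a < b)%N)
       (u b - u a) *: (horner_alg (opxi (lo i)) (lagrangeP u a) *
                       horner_alg (opxi (hi i)) (lagrangeP u b)).
  apply: lendoP => f; rewrite !(lendo_mulE, lendo_addE) /= indT_indxi_lo //.
  congr (_ + _); apply/ffunP => d; rewrite ffunE lendo_sumE sum_ffunE.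
  rewrite (bigD1 (d (lo i))) //= [X in _ = _ + X]big1 => [|a ad].
    rewrite addr0 lendo_sumE sum_ffunE.
    (* Unless [d (lo i) < d (hi i)], no admissible [b] equals [d (hi i)], and every summand
       vanishes. *)
    case: ifP => dd; last first.
      rewrite big1 // => b db; rewrite ffunE lendo_mulE !horner_opxi.
      rewrite [(lagrangeP u b).[_]]lagrangeP_node //.
      have [bd|] := eqVneq b (d (hi i)); first by rewrite -bd db in dd.
      by rewrite scale0r !scaler0.
    rewrite (bigD1 (d (hi i))) //= big1 ?addr0 => [|b /andP[_ bd]].
      by rewrite ffunE !horner_opxi !lagrangeP_node // !eqxx !scale1r.
    rewrite ffunE !horner_opxi [(lagrangeP u b).[_]]lagrangeP_node //.
    by rewrite (negbTE bd) scale0r !scaler0.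
  rewrite lendo_sumE sum_ffunE big1 // => b _.
  rewrite ffunE !horner_opxi [(lagrangeP u a).[_]]lagrangeP_node //.
  by rewrite (negbTE ad) scale0r !scaler0.
have /AKS_universal[rho [rhoT rhoxi _]] : forall a b,
    AKS_relation u opT opxi a b -> a = b; last first.
  by exists rho; split=> [i|k] f; rewrite (rhoT, rhoxi).
move=> _ _ [i|i j ij|i j ij|j|i j|i|i|i j ji ji'].
- apply: lendoP => f; rewrite lendo_mulE lendo_addE lendoD /=.
  by rewrite indT_quad // addNr.
- by apply: lendoP => f; apply: indT_braid.
- by apply: lendoP => f; apply: indT_comm.
- apply: lendoP => f; apply/ffunP => d; rewrite prod_horner_alg horner_opxi.
  rewrite horner_prod (bigD1 (d j)) //= hornerXsubC subrr mul0r scale0r.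
  by rewrite ffunE.
- by apply: lendoP => f; apply: indxi_comm.
- exact: xi_lo_mul.
- apply: lendoP => f; rewrite lendo_mulE !lendo_addE lendoD /=.
  rewrite indT_indxi_lo // indT_indxi_hi //.
  by rewrite addrACA subrr addr0 addrC.
- by apply: lendoP => f; apply: indT_indxi_far.
Qed.

End Representations.

(** * Commuting the T_i past the idempotents L_c *)

Section ColorIdempotents.
Variables (F : fieldType) (n r : nat) (u : 'I_r.+1 -> F).
Hypothesis u_inj : injective u.

Variables (A : algType F) (T : 'I_n -> A) (xi : 'I_n.+1 -> A).
Hypothesis AKS_rel : forall a b, AKS_relation u T xi a b -> a = b.

(** Stated for elements of any algebra that satisfy the relations; for the generators of [AKS] it
    unfolds to [Lword]. *)
Definition Lprod (c : colorword n r) : A :=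
  \prod_(j < n.+1) horner_alg (xi j) (lagrangeP u (c j)).
Local Notation L := Lprod.
Implicit Types (i : 'I_n) (j k : 'I_n.+1) (c d : colorword n r).

Lemma T_quad i : T i * T i = - T i.
Proof.
have /eqP := AKS_rel (rel_quad u T xi i).
by rewrite mulrDr mulr1 addr_eq0 => /eqP.
Qed.

Lemma xi_comm j k : GRing.comm (xi j) (xi k).
Proof. exact: AKS_rel (rel_xi u T xi j k). Qed.

Lemma xi_horner_comm j k p : GRing.comm (xi j) (horner_alg (xi k) p).
Proof.
elim/poly_ind: p => [|p a IHp]; first by rewrite raddf0; apply: commr0.
rewrite rmorphD rmorphM /= horner_algX horner_algC.
apply: commrD; first by apply: commrM => //; apply: xi_comm.
by rewrite /GRing.comm comm_alg.
Qed.

Lemma xi_Lprod_comm j c : GRing.comm (xi j) (L c).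
Proof. by apply: commr_prod => k _; apply: xi_horner_comm. Qed.

(** The product of ['X - (u k)%:P] and [lagrangeP u k] is a multiple of the polynomial that
    annihilates [xi j]. *)
Lemma xi_lagrange j (k : 'I_r.+1) :
  xi j * horner_alg (xi j) (lagrangeP u k) = u k *: horner_alg (xi j)
    (lagrangeP u k).
Proof.
apply/eqP; rewrite -subr_eq0 -[_ *: _]mulr_algl -mulrBl.
have -> : xi j - (u k)%:A = horner_alg (xi j) ('X - (u k)%:P).
  by rewrite rmorphB /= horner_algX horner_algC.
have [a aE] := lagrangeP_mulXsubC u k; rewrite -rmorphM /= aE -mul_polyC
  rmorphM /=.
by rewrite -prod_horner_alg (AKS_rel (rel_min u T xi j)) mulr0.
Qed.

Lemma xi_Lprod j c : xi j * L c = u (c j) *: L c.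
Proof.
rewrite /Lprod.
have: j \in index_enum 'I_n.+1 by rewrite mem_index_enum.
elim: (index_enum _) => // k s IHs; rewrite big_cons inE.
have [->|_] /= := eqVneq j k; first by rewrite mulrA xi_lagrange scalerAl.
by move=> /IHs e; rewrite mulrA xi_horner_comm -mulrA e scalerAr.
Qed.

Lemma Lprod_xi j c : L c * xi j = u (c j) *: L c.
Proof. by rewrite -xi_Lprod_comm xi_Lprod. Qed.

Lemma horner_alg_eigen (B : algType F) (x v : B) a p :
  x * v = a *: v -> horner_alg x p * v = p.[a] *: v.
Proof.
move=> xv; elim/poly_ind: p => [|p b IHp];
  first by rewrite raddf0 mul0r horner0 scale0r.
rewrite rmorphD rmorphM /= horner_algX horner_algC hornerMXaddC mulrDl -mulrA
  xv.
by rewrite -scalerAr IHp scalerA mulr_algl scalerDl mulrC.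
Qed.

Lemma sum_Lprod : \sum_c L c = 1.
Proof.
rewrite -[LHS](bigA_distr_bigA (fun j (k : 'I_r.+1) => horner_alg (xi j)
  (lagrangeP u k))).
by rewrite big1 // => j _; rewrite -rmorph_sum sum_lagrangeP // rmorph1.
Qed.

Lemma eigen_eq0 (B : lmodType F) (x : B) a b : a *: x = b *: x -> a != b -> x =
  0.
Proof.
move=> e ab; apply/eqP; have /eqP := e.
by rewrite -subr_eq0 -scalerBl scaler_eq0 subr_eq0 (negbTE ab).
Qed.

(** If the words differ at [j], moving [xi j] through the product gives it two different
    eigenvalues. Idempotence then follows from [sum_Lprod]. *)
Lemma Lprod_mul c d : L c * L d = if c == d then L c else 0.
Proof.
have orth c' d' : c' != d' -> L c' * L d' = 0.
  move=> cd; have /existsP[j jcd] : [exists j, c' j != d' j].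
    apply: contraNT cd => /existsPn e; apply/eqP/ffunP => j; apply/eqP.
    by have := e j; rewrite negbK.
  apply: (@eigen_eq0 _ _ (u (c' j)) (u (d' j))); last by rewrite (inj_eq u_inj).
  by rewrite scalerAl -Lprod_xi -mulrA xi_Lprod scalerAr.
have [<-|] := eqVneq c d; last exact: orth.
rewrite -[RHS]mulr1 -sum_Lprod mulr_sumr (bigD1 c) //= big1 ?addr0 // => e ec.
by rewrite orth // eq_sym.
Qed.

Let delta i : A := \sum_(a < r.+1) \sum_(b < r.+1 | (a < b)%N)
       (u b - u a) *: (horner_alg (xi (lo i)) (lagrangeP u a) *
                       horner_alg (xi (hi i)) (lagrangeP u b)).

Lemma correction_Lprod i c : delta i * L c =
  (if (c (lo i) < c (hi i))%N then u (c (hi i)) - u (c (lo i)) else 0) *: L c.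
Proof.
have E a b : (u b - u a) *: (horner_alg (xi (lo i)) (lagrangeP u a) *
    horner_alg (xi (hi i)) (lagrangeP u b)) * L c =
    ((u b - u a) * (a == c (lo i))%:R * (b == c (hi i))%:R) *: L c.
  rewrite -scalerAl -[_ * _ * L c]mulrA (horner_alg_eigen _ (xi_Lprod _ _)).
  rewrite -scalerAr (horner_alg_eigen _ (xi_Lprod _ _)) !scalerA.
  by rewrite !lagrangeP_node // mulrAC.
rewrite mulr_suml (bigD1 (c (lo i))) //= [X in _ + X]big1 ?addr0 => [|a ac].
  rewrite mulr_suml; case: ifP => cc; last first.
    rewrite scale0r big1 // => b cb; rewrite E.
    have [bc|] := eqVneq b (c (hi i)); first by rewrite -bc cb in cc.
    by rewrite mulr0 scale0r.
  rewrite (bigD1 (c (hi i))) //= E !eqxx !mulr1 big1 ?addr0 // => b /andP[_ bc].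
  by rewrite E (negbTE bc) mulr0 scale0r.
by rewrite mulr_suml big1 // => b _; rewrite E (negbTE ac) mulr0 mul0r scale0r.
Qed.

Lemma T_xi_lo i : T i * xi (lo i) = xi (hi i) * T i + delta i.
Proof. exact: AKS_rel (rel_mixed u T xi i). Qed.

Lemma T_xi_hi i : T i * xi (hi i) = xi (lo i) * T i - delta i.
Proof.
have := AKS_rel (rel_sum u T xi i); rewrite mulrDl mulrDr T_xi_lo.
by move=> e; apply: (addrI (xi (hi i) * T i + delta i)); rewrite e; zmod.
Qed.

(** [T i] commutes with the distant [xi k] and exchanges the two near ones up to [delta i]; as
    [delta i * L c] is a multiple of [L c], it is killed by [L d]. A position where [d] and
    [swapw i c] differ thus yields two different eigenvalues. *)
Lemma Lprod_T_Lprod i c d : d != c -> d != swapw i c -> L d * T i * L c = 0.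
Proof.
move=> dc ds; have D : L d * (delta i * L c) = 0.
  by rewrite correction_Lprod -scalerAr Lprod_mul (negbTE dc) scaler0.
have far k : k != lo i -> k != hi i -> d k != c k -> L d * T i * L c = 0.
  move=> kl kh dk; apply: (@eigen_eq0 _ _ (u (d k)) (u (c k)));
    last by rewrite (inj_eq u_inj).
  rewrite !scalerAl -Lprod_xi -!mulrA !(mulrA (xi k)).
  by rewrite -(AKS_rel (rel_far u T xi kl kh)) -mulrA xi_Lprod -!scalerAr
    scalerAl.
have Dlo : d (hi i) != c (lo i) -> L d * T i * L c = 0.
  move=> dk; apply: (@eigen_eq0 _ _ (u (d (hi i))) (u (c (lo i))));
    last by rewrite (inj_eq u_inj).
  rewrite !scalerAl -Lprod_xi -!scalerAl -!mulrA scalerAr scalerAr -xi_Lprod.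
  by rewrite !(mulrA (T i)) T_xi_lo mulrDl mulrDr D addr0 -!mulrA.
have Dhi : d (lo i) != c (hi i) -> L d * T i * L c = 0.
  move=> dk; apply: (@eigen_eq0 _ _ (u (d (lo i))) (u (c (hi i))));
    last by rewrite (inj_eq u_inj).
  rewrite !scalerAl -Lprod_xi -!scalerAl -!mulrA scalerAr scalerAr -xi_Lprod.
  by rewrite !(mulrA (T i)) T_xi_hi mulrBl mulrBr D subr0 -!mulrA.
have /existsP[k dk] : [exists k, d k != swapw i c k].
  apply: contraNT ds => /existsPn e; apply/eqP/ffunP => k; apply/eqP.
  by have := e k; rewrite negbK.
have [kl|kl] := eqVneq k (lo i); first by apply: Dhi; rewrite kl swapw_lo in dk.
have [kh|kh] := eqVneq k (hi i); first by apply: Dlo; rewrite kh swapw_hi in dk.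
by apply: (far k kl kh); rewrite -(swapw_far c kl kh).
Qed.

(** Between two copies of [L c], the [xi] of the mixed relation become scalars, whose nonzero
    difference can be divided out. *)
Lemma Lprod_T_diag i c : c (lo i) != c (hi i) ->
  L c * T i * L c = if (c (lo i) < c (hi i))%N then - L c else 0.
Proof.
move=> cc; have cu : u (c (lo i)) - u (c (hi i)) != 0 by rewrite subr_eq0
  (inj_eq u_inj).
apply: (scalerI cu).
have -> : (u (c (lo i)) - u (c (hi i))) *: (L c * T i * L c) = L c * (delta i *
  L c).
  have lo_eigen : u (c (lo i)) *: (L c * T i * L c) = L c * (T i * xi (lo i)) *
    L c.
    by rewrite scalerAr -xi_Lprod !mulrA.
  have hi_eigen : u (c (hi i)) *: (L c * T i * L c) = L c * (xi (hi i) * T i) *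
    L c.
    by rewrite !scalerAl -Lprod_xi !mulrA.
  rewrite scalerBl lo_eigen hi_eigen T_xi_lo mulrDr mulrDl.
  by rewrite addrC addKr mulrA.
rewrite correction_Lprod -scalerAr Lprod_mul eqxx.
by case: ifP => _; rewrite ?scale0r ?scaler0 // scalerN -scaleNr opprB.
Qed.

(** For distinct letters, inserting [sum_Lprod] to the left of [T i * L c] and to the right of
    [L (swapw i c) * T i] leaves two blocks each: a common one, and a diagonal one given by
    [Lprod_T_diag]. For equal letters only the block [L c * T i * L c] is left on both sides. *)
Lemma T_Lprod i c : T i * L c = L (swapw i c) * T i +
  (if (c (hi i) < c (lo i))%N then L (swapw i c) else 0) -
  (if (c (lo i) < c (hi i))%N then L c else 0).
Proof.
have [cc|cc] := eqVneq (c (lo i)) (c (hi i)).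
  rewrite cc ltnn swapw_id // subr0 addr0.
  rewrite -[LHS]mul1r -[RHS]mulr1 -sum_Lprod mulr_suml mulr_sumr;
    apply: eq_bigr => d _.
  have [->|dc] := eqVneq d c; first by rewrite mulrA.
  have sc := swapw_id cc.
  rewrite mulrA !Lprod_T_Lprod ?sc // 1?eq_sym //.
  by apply: contraNneq dc => e; rewrite -sc -e swapwK.
have sc : swapw i c != c.
  by apply: contraNneq cc => /(congr1 (fun w : colorword n r => w (lo i))) /=;
    rewrite swapw_lo => ->.
have lhs : T i * L c = L (swapw i c) * T i * L c + L c * T i * L c.
  rewrite -[LHS]mul1r -sum_Lprod mulr_suml (bigD1 (swapw i c)) //= mulrA;
    congr (_ + _).
  rewrite (bigD1 c) ?[c == _]eq_sym //= mulrA big1 ?addr0 // => d /andP[d1 d2].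
  by rewrite mulrA Lprod_T_Lprod.
have rhs : L (swapw i c) * T i =
    L (swapw i c) * T i * L c + L (swapw i c) * T i * L (swapw i c).
  rewrite -[LHS]mulr1 -sum_Lprod mulr_sumr (bigD1 c) //=; congr (_ + _).
  rewrite (bigD1 (swapw i c)) //= big1 ?addr0 // => d /andP[d1 d2].
  rewrite Lprod_T_Lprod // eq_sym //.
  by apply: contraNneq d1 => e; rewrite -(swapwK i d) e swapwK.
rewrite lhs [in RHS]rhs !Lprod_T_diag // ?swapw_lo ?swapw_hi 1?eq_sym //.
case: (ltngtP (c (lo i)) (c (hi i))) => [||/val_inj] h;
  [zmod | zmod | by rewrite h eqxx in cc].
Qed.

End ColorIdempotents.

(** * Injectivity of left multiplication by [L c] on the 0-Hecke algebra *)

Section HeckeInjectivity.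
Variables (F : fieldType) (n r : nat) (u : 'I_r.+1 -> F).
Hypothesis u_inj : injective u.
Local Notation L := (@Lword F n r u).

(* Induce a representation [theta] on [A]: [x] in [H_n(0)] sends the constant
   function [1 = \sum_c L_c (x) 1] to the constant function [theta x]. *)
Lemma Lword_hecke0_rep (A : algType F) (theta : {lrmorphism AKS n u -> A}) c
    (x : AKS n u) : hecke0 x -> L c * x = 0 -> theta x = 0.
Proof.
move=> xH Lx.
pose T i := theta (genT u i); pose xi j := theta (genxi u j).
have AKS_rel a b : AKS_relation u T xi a b -> a = b.
  move=> /(AKS_relation_lift (f := theta))[a' [b' [ab -> ->]]].
  by rewrite (AKS_relations ab).
pose cst (v : A) := [ffun => v] : {ffun colorword n r -> A}.
have nzW : exists f : {ffun colorword n r -> A}, f != 0.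
  exists (cst 1); apply/negP => /eqP/(congr1 (fun f : {ffun colorword n r -> A}
    => f c)).
  by rewrite !ffunE => /eqP; rewrite oner_eq0.
have [||||rho [rhoT rhoxi]] :=
  @AKS_induced_rep F n r u u_inj A (fun i v => T i * v) _ _ _ _ nzW.
- by move=> i a v w; rewrite mulrDr scalerAr.
- by move=> i v; rewrite mulrA (T_quad AKS_rel) mulNr.
- by move=> i j v ij; rewrite !mulrA (AKS_rel _ _ (rel_braid u T xi ij)).
- by move=> i j v ij; rewrite !mulrA (AKS_rel _ _ (rel_comm u T xi ij)).
(* The difference terms of [indT] vanish on constant functions, so there [genT u i] acts through
   [theta]. The elements acting in this way form a subalgebra, which contains [x] by definition of
   [hecke0]. *)
have rho_cst : forall v, rho x (cst v) = cst (theta x * v).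
  pose S : {pred AKS n u} := fun y => `[< forall v, rho y (cst v) = cst (theta
    y * v) >].
  suff /asboolP : x \in S by [].
  apply: xH => [|i]; last first.
    apply/asboolP => v; rewrite rhoT; apply/ffunP => d; rewrite !ffunE.
    by rewrite subrr if_same addr0.
  split=> [|a y z /asboolP yS /asboolP zS|y z /asboolP yS /asboolP zS];
    apply/asboolP => v.
  - by rewrite !rmorph1 mul1r.
  - rewrite !linearP [LHS]/= yS zS.
    by apply/ffunP => d; rewrite !ffunE mulrDl scalerAl.
  - by rewrite !rmorphM /= zS yS mulrA.
(* Each factor of [L c] multiplies the component at [c] by the value of a Lagrange polynomial at its
   own node, which is 1. *)
have rhoL f : rho (L c) f c = f c.
  have rho_xi j (g : {ffun colorword n r -> A}) p :
      horner_alg (rho (genxi u j)) p g c = p.[u (c j)] *: g c.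
    elim/poly_ind: p g => [|p a IHp] g; first by rewrite raddf0 horner0 scale0r
      /= ffunE.
    rewrite rmorphD rmorphM /= horner_algX horner_algC hornerMXaddC.
    by rewrite ffunE IHp rhoxi !ffunE scalerA scalerDl.
  rewrite /Lword rmorph_prod /=; elim: (index_enum _) f => [|j s IHs] f;
    first by rewrite big_nil.
  by rewrite big_cons lendo_mulE horner_alg_lrmorph rho_xi lagrangeP_node //
    eqxx scale1r.
have := rhoL (rho x (cst 1)); rewrite -lendo_mulE -rmorphM Lx raddf0 rho_cst
  mulr1.
by rewrite /= !ffunE => <-.
Qed.

Lemma Lword_hecke0_eq0 c (x : AKS n u) : hecke0 x -> L c * x = 0 -> x = 0.
Proof. exact: (@Lword_hecke0_rep (AKS n u) idfun). Qed.

End HeckeInjectivity.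

(** * Eigenvectors of the 0-Hecke algebra *)

Section HeckeEigenvectors.
Variables (A : pzRingType) (t : nat -> A).

Definition zT (b : bool) (i : nat) : A := if b then - t i else 1 + t i.

Definition zprod (l : seq (bool * nat)) : A := \prod_(p <- l) zT p.1 p.2.

Definition zrow (b : bool) (m : nat) : seq (bool * nat) :=
  [seq (b, i) | i <- iota 0 m].

(** Row [k], counted from 0, has kind [b k] and runs over the indices below [m - k]; together the
    indices form a reduced word of the longest permutation of [m.+1] letters. *)
Fixpoint zstair (b : nat -> bool) (m : nat) : seq (bool * nat) :=
  if m is m'.+1 then zrow (b 0%N) m ++ zstair (b \o succn) m' else [::].

Lemma zprod_cat l l' : zprod (l ++ l') = zprod l * zprod l'.
Proof. exact: big_cat. Qed.

Lemma zprod_cons p l : zprod (p :: l) = zT p.1 p.2 * zprod l.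
Proof. exact: big_cons. Qed.

Hypothesis t_quad : forall i, t i * t i = - t i.
Hypothesis t_braid : forall i, t i * t i.+1 * t i = t i.+1 * t i * t i.+1.
Hypothesis t_comm : forall i j, (i.+1 < j)%N -> t i * t j = t j * t i.

Lemma zT_idem b i : zT b i * zT b i = zT b i.
Proof.
case: b; rewrite /zT; first by rewrite mulrNN t_quad.
by rewrite mulrDl mul1r mulrDr mulr1 t_quad subrr addr0.
Qed.

Lemma zT_compl b i : zT (~~ b) i = 1 - zT b i.
Proof. by case: b; rewrite /zT /= ?opprK // opprD addrA subrr add0r. Qed.

Lemma zT_braid b i :
  zT b i * zT b i.+1 * zT b i = zT b i.+1 * zT b i * zT b i.+1.
Proof.
case: b; rewrite /zT; first by rewrite !mulrNN !mulrN t_braid.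
rewrite !(mulrDl, mulrDr, mul1r, mulr1) !t_quad t_braid; zmod.
Qed.

Lemma zT_comm b b' i j : (i.+1 < j)%N -> GRing.comm (zT b i) (zT b' j).
Proof.
move=> ij; have tij : GRing.comm (t i) (t j) by exact: t_comm.
have zij : GRing.comm (zT b i) (t j).
  case: b; rewrite /zT; apply: commr_sym; first exact/commrN/commr_sym.
  by apply: commrD; [exact: commr1 | exact: commr_sym].
by case: b'; rewrite /zT; [exact: commrN | apply: commrD => //; apply: commr1].
Qed.

(* [z_0 ... z_(m-1)] is a shift: it carries an eigenvector for the first m-1
   generators to one for the generators 1, ..., m-1. *)
Lemma zT_zrow b b' m i : (i.+1 < m)%N ->
  zT b' i.+1 * zprod (zrow b m) = zprod (zrow b m) * zT b' i.
Proof.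
(* The case [b' = b] suffices, since the other idempotent is 1 minus this one. *)
move=> im; suff E : zT b i.+1 * zprod (zrow b m) = zprod (zrow b m) * zT b i.
  have [->//|/negbTE bb] := eqVneq b' b.
  have -> : b' = ~~ b by case: b b' bb {E} => [] [].
  by rewrite !zT_compl mulrBl mulrBr mul1r mulr1 E.
(* Isolate the factors [i] and [i.+1]: [zT b i.+1] passes those before them, the braid relation
   turns it into [zT b i], and this passes those after them. *)
have -> : zrow b m = zrow b i ++ (b, i) :: (b, i.+1) ::
    [seq (b, k) | k <- iota i.+2 (m - i.+2)].
  by rewrite /zrow -[in LHS](subnKC im) !addSn -!addnS iotaD map_cat add0n.
rewrite /zprod big_cat !big_cons /=.
set X := \prod_(p <- zrow b i) _; set Y := \prod_(p <- map _ _) _.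
have XC : GRing.comm (zT b i.+1) X.
  rewrite /X big_seq; apply: commr_prod => p /mapP[k].
  by rewrite mem_iota => /andP[_ ki] ->; apply/commr_sym/zT_comm.
have YC : GRing.comm (zT b i) Y.
  rewrite /Y big_seq; apply: commr_prod => p /mapP[k].
  by rewrite mem_iota => /andP[ik _] ->; apply: zT_comm.
by rewrite mulrA XC -!mulrA -YC; congr (_ * _); rewrite !mulrA zT_braid.
Qed.

(** The first row begins with the idempotent of index 0. A larger index drops by one on passing this
    row and meets the staircase of the shifted [b]. *)
Lemma zT_zstair b m i : (i < m)%N ->
  zT (b i) i * zprod (zstair b m) = zprod (zstair b m).
Proof.
elim: m b i => // m IHm b [|i] im.
  by rewrite /= zprod_cons mulrA zT_idem.
have -> : zstair b m.+1 = zrow (b 0%N) m.+1 ++ zstair (b \o succn) m by [].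
rewrite zprod_cat.
by rewrite mulrA zT_zrow // -mulrA (IHm (b \o succn)).
Qed.

End HeckeEigenvectors.

(** * Sorting words along the staircase *)

Section StaircaseWords.
Variable n : nat.
Implicit Types (d w : colorword n n).

(** Sorting is towards decreasing order, so it creates inversions. Indices out of range act
    trivially, in accordance with generators extended by 0. *)
Definition sortw (i : nat) d : colorword n n :=
  if insub i is Some k then
    if (d (lo k) < d (hi k))%N then swapw k d else d
  else d.

(** As [y_i] sends [f] to [f \o sortw i], the leftmost factor of a product of operators sorts
    first. *)
Definition runw (l : seq (bool * nat)) d : colorword n n :=
  foldl (fun e p => sortw p.2 e) d l.

Definition invw d : nat :=
  (\sum_(p < n.+1) \sum_(q < n.+1) ((p < q) && (d q < d p)))%N.

(** After reindexing by the transposition [s], the order [s p < s q] implies [p < q] except for the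
    single pair [(hi i, lo i)], so at most one inversion is new. *)
Lemma invw_swapw (i : 'I_n) d : (invw (swapw i d) <= (invw d).+1)%N.
Proof.
pose s := tperm (lo i) (hi i).
have -> : invw (swapw i d) =
    (\sum_(p < n.+1) \sum_(q < n.+1) ((s p < s q) && (d q < d p)))%N.
  rewrite /invw [LHS](reindex_inj (@perm_inj _ s)); apply: eq_bigr => p _.
  rewrite [LHS](reindex_inj (@perm_inj _ s)); apply: eq_bigr => q _.
  by rewrite !ffunE !tpermK.
have one : (\sum_(p < n.+1) \sum_(q < n.+1) ((p == hi i) && (q == lo i)) = 1)%N.
  rewrite (bigD1 (hi i)) //= (bigD1 (lo i)) //= !eqxx /= !big1 ?addn0 // => p
    ph.
    by rewrite big1 // => q _; rewrite (negbTE ph).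
  by rewrite (negbTE ph).
apply: leq_trans (_ : _ <= invw d + 1)%N _; last by rewrite addn1.
rewrite -one /invw -big_split leq_sum // => p _;
  rewrite -big_split leq_sum // => q _ /=.
have [->|qp] := eqVneq p q; first by rewrite !ltnn.
have : (s p < s q)%N ==> (p < q)%N || (p == hi i) && (q == lo i).
  move: qp; rewrite /s -!val_eqE /=.
  case: tpermP => [->|->|/eqP p1 /eqP p2];
    case: tpermP => [->|->|/eqP q1 /eqP q2];
    rewrite /= /bump /= ?leq0n ?add1n; try move: p1 p2; try move: q1 q2;
      rewrite -?val_eqE /= /bump /=; lia.
by case: (_ < _)%N; case: (_ < _)%N; case: (_ && _); case: (_ < _)%N.
Qed.

Lemma invw_sortw i d : (invw (sortw i d) <= (invw d).+1)%N.
Proof.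
rewrite /sortw; case: insubP => [k _ _|_] //; case: ifP => _ //.
exact: invw_swapw.
Qed.

Lemma invw_runw l d : (invw (runw l d) <= invw d + size l)%N.
Proof.
elim: l d => [|p l IHl] d /=; first by rewrite addn0.
by apply: leq_trans (IHl _) _; rewrite addnS -addSn leq_add2r invw_sortw.
Qed.

Definition idw : colorword n n := [ffun p => p].
Definition revw : colorword n n := [ffun p => rev_ord p].

Lemma invw_idw : invw idw = 0%N.
Proof. by rewrite /invw big1 // => p _; rewrite big1 // => q _;
  rewrite !ffunE; lia. Qed.

Lemma invw_revw b : invw revw = size (zstair b n).
Proof.
have -> : size (zstair b n) = (\sum_(q < n.+1) q)%N.
  elim: (n) b => [|m IHm] b /=; first by rewrite big_ord1.
  by rewrite size_cat size_map size_iota IHm [RHS]big_ord_recr /= addnS addnC.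
rewrite /invw exchange_big; apply: eq_bigr => q _ /=.
under eq_bigr => p _.
  rewrite !ffunE /= (_ : (_ && _) = (p < q)%N); last by have := ltn_ord p;
    have := ltn_ord q; lia.
  over.
rewrite -[RHS]card_ord -sum1_card (big_ord_widen _ (fun=> 1%N) (ltnW (ltn_ord
  q))).
by rewrite [RHS]big_mkcond; apply: eq_bigr => p _; case: (_ < _)%N.
Qed.

(** The letter at position [p] after [j] sorts of the row over the indices 0 to [m]. In this row the
    letter [n - m.+1] travels from position 0 to [m.+1] past larger ones; the positions beyond
    [m.+1] already carry the reversed word. *)
Let state (m j p : nat) : nat :=
  if (p < j)%N then (p + (n - m))%N
  else if p == j then (n - m.+1)%N
  else if (p <= m.+1)%N then (p + (n - m.+1))%N
  else (n - p)%N.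

Let word (g : nat -> nat) : colorword n n := [ffun p : 'I_n.+1 => inord (g p)].

Let word_eq g g' : (forall p, (p <= n)%N -> g p = g' p) -> word g = word g'.
Proof. by move=> e; apply/ffunP => p; rewrite !ffunE e // -ltnS. Qed.

Lemma sortw_state m j : (j <= m)%N -> (m < n)%N ->
  sortw j (word (state m j)) = word (state m j.+1).
Proof.
move=> jm mn; have jn := leq_ltn_trans jm mn.
rewrite /sortw insubT; set k := Sub j jn; have kj : k = j :> nat by [].
have B p q : (q <= m.+1)%N -> (p <= n)%N -> (state m q p < n.+1)%N.
  by move=> qm pn; rewrite /state; do !case: ifP; lia.
rewrite !ffunE !inordK ?B //= ?/bump ?leq0n ?add1n ?leqnSn //; try lia.
have -> : (state m j j < state m j j.+1)%N by rewrite /state; do !case: ifP;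
  lia.
apply/ffunP => p; rewrite !ffunE; congr (inord _).
have pn := ltn_ord p.
case: tpermP => [->|->|/eqP p1 /eqP p2] /=; rewrite /bump ?leq0n ?add1n /state.
- by do !case: ifP; lia.
- by do !case: ifP; lia.
- by move: p1 p2; rewrite -!val_eqE /= /bump /=; do !case: ifP; lia.
Qed.

Lemma runw_zrow b m j l : (j + l <= m.+1)%N -> (m < n)%N ->
  runw [seq (b, i) | i <- iota j l] (word (state m j)) = word (state m (j + l)).
Proof.
move=> + mn; elim: l j => [|l IHl] j jl /=; first by rewrite addn0.
by rewrite sortw_state ?IHl ?addSnnS //; lia.
Qed.

Lemma runw_zstair b : runw (zstair b n) idw = revw.
Proof.
have revE : word (fun p => n - p)%N = revw.
  by apply/ffunP => p; apply/val_inj; rewrite !ffunE /= inordK;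
    have := ltn_ord p; lia.
(* Induction on the remaining rows: the word ending one row is the one starting the next, and the
   last row ends at the reversed word. *)
have run m : (m < n)%N -> runw (zstair b m.+1) (word (state m 0)) = revw.
  elim: m b => [|m IHm] c mn.
    rewrite -revE [zstair c 1]/(zrow (c 0%N) 1) (@runw_zrow _ 0 0 1) //.
    by apply: word_eq => p pn; rewrite /state; do !case: ifP; lia.
  have -> : zstair c m.+2 = zrow (c 0%N) m.+2 ++ zstair (c \o succn) m.+1 by [].
  rewrite /runw foldl_cat -/(runw _ _) -/(runw _ _) runw_zrow //.
  rewrite -(IHm (c \o succn)) 1?ltnW //; congr runw; apply: word_eq => p pn.
  by rewrite /state; do !case: ifP; lia.
(* [run] starts from at least one row; for [n = 0] the staircase is empty and words have a single
   position. *)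
have [n0|n0] := posnP n.
  apply/ffunP => p; apply/val_inj; rewrite (_ : zstair b n = [::]) ?n0 //.
  by rewrite !ffunE /=; have := ltn_ord p; lia.
rewrite -(run n.-1) ?prednK //; congr runw; apply/ffunP => p; apply/val_inj.
have pn := ltn_ord p; have E : state n.-1 0 p = p :> nat.
  by rewrite /state; do !case: ifP; lia.
by rewrite !ffunE /= inordK E.
Qed.

End StaircaseWords.

(** * Nonvanishing of the staircase product *)

Section StaircaseNonzero.
Variables (F : fieldType) (n : nat).
Local Notation W := {ffun colorword n n -> F^o}.
Variables (nzW : exists f : W, f != 0) (tau : nat -> lendo nzW).
Hypothesis tauE : forall i (f : W) d, tau i f d = f (sortw i d) - f d.

(* Expanding the product, only the summand in which every factor sorts is long
   enough to reach a word with [invw d + size l] inversions. *)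
Lemma zprod_delta l (d w : colorword n n) : (invw d + size l <= invw w)%N ->
  zprod tau l [ffun e => (e == w)%:R : F^o] d =
    if runw l d == w then (-1) ^+ count (fun p => p.1) l else 0.
Proof.
elim: l d => [|[b i] l IHl] d /= dl.
  by rewrite /zprod big_nil /= ffunE; case: eqP.
have dl' : (invw d + size l < invw w)%N by rewrite -addnS.
rewrite zprod_cons lendo_mulE /= /zT.
have sl : (invw (sortw i d) + size l <= invw w)%N.
  by apply: leq_trans dl; rewrite addnS -addSn leq_add2r invw_sortw.
case: b => /=.
  rewrite ffunE tauE !IHl // 1?ltnW //.
  (* If this factor does not sort, the remaining sorts are too few to reach the inversions of
     [w]. *)
  have /negbTE -> : runw l d != w.
    apply: contraTneq dl' => <-; rewrite -leqNgt; exact: invw_runw.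
  by rewrite subr0 add1n exprS; case: ifP => _; rewrite ?oppr0 // mulN1r.
by rewrite ffunE tauE addrC subrK IHl.
Qed.

Lemma zprod_zstair_neq0 b : zprod tau (zstair b n) != 0.
Proof.
apply/negP => /eqP z0.
have := @zprod_delta (zstair b n) (idw n) (revw n).
rewrite invw_idw -(invw_revw n b) add0n leqnn runw_zstair eqxx z0 /= ffunE.
by move=> /(_ isT)/esym/eqP; rewrite expf_eq0 oppr_eq0 oner_eq0 andbF.
Qed.

End StaircaseNonzero.

(** * Generators indexed by all natural numbers *)

Section ExtendedGenerators.
Variables (F : fieldType) (n : nat) (A : algType F) (T : 'I_n -> A).
Hypothesis T_quad : forall i, T i * T i = - T i.
Hypothesis T_braid : forall i j : 'I_n, j = i.+1 :> nat ->
  T i * T j * T i = T j * T i * T j.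
Hypothesis T_comm : forall i j : 'I_n, (i.+1 < j)%N || (j.+1 < i)%N ->
  T i * T j = T j * T i.

(* Extended by 0 to all indices, the generators satisfy the relations without
   bounds on the indices. *)
Definition natT (i : nat) : A := oapp T 0 (insub i).

Lemma natT_ord (i : 'I_n) : natT i = T i.
Proof. by rewrite /natT valK. Qed.

Lemma natT_quad i : natT i * natT i = - natT i.
Proof. by rewrite /natT; case: insubP => [k _ _|_] /=;
  rewrite ?T_quad ?mul0r ?oppr0. Qed.

Lemma natT_braid i : natT i * natT i.+1 * natT i = natT i.+1 * natT i * natT
  i.+1.
Proof.
rewrite /natT; case: insubP => [k _ ki|_] /=; last by rewrite ?(mulr0, mul0r).
case: insubP => [l _ li|_] /=; last by rewrite ?(mulr0, mul0r).
by apply: T_braid; rewrite ki li.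
Qed.

Lemma natT_comm i j : (i.+1 < j)%N -> natT i * natT j = natT j * natT i.
Proof.
move=> ij; rewrite /natT; case: insubP => [k _ ki|_] /=;
  last by rewrite ?(mulr0, mul0r).
case: insubP => [l _ li|_] /=; last by rewrite ?(mulr0, mul0r).
by apply: T_comm; rewrite ki li ij.
Qed.

Lemma zprod_subalg (S : {pred A}) l : GRing.subalg_closed S ->
  (forall i, T i \in S) -> zprod natT l \in S.
Proof.
move=> [S1 Slin Smul] ST.
have S0 : 0 \in S by rewrite -(addNr (1 : A)) -scaleN1r Slin.
have natS i : natT i \in S by rewrite /natT; case: insubP => [k _ _|_] /=.
elim: l => [|[b i] l IHl]; first by rewrite /zprod big_nil.
rewrite zprod_cons Smul //=; case: b; rewrite /zT.
  by rewrite -scaleN1r -[_ *: _]addr0 Slin.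
by rewrite -[1]scale1r Slin.
Qed.

End ExtendedGenerators.

(** * Existence of the eigenvectors [eta] *)

Section EtaExists.
Variables (F : fieldType) (n r : nat) (u : 'I_r.+1 -> F).

Lemma zprod_rmorph (A B : pzRingType) (f : {rmorphism A -> B}) (t : nat -> A) l
  :
  f (zprod t l) = zprod (f \o t) l.
Proof.
rewrite /zprod rmorph_prod; apply: eq_bigr => -[[] i] _ /=.
  by rewrite rmorphN.
by rewrite rmorphD rmorph1.
Qed.

(** This is [indT] for the zero action on [F]. The words use [n.+1] letters whatever the number of
    colors, so only the [T_i] keep their induced action, and [AKS_hecke_rep] supplies that of the
    [xi]. *)
Lemma sort_rep (nzW : exists f : {ffun colorword n n -> F^o}, f != 0) :
  exists rho : {lrmorphism AKS n u -> lendo nzW}, forall i f d,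
    rho (natT (genT u) i) f d = f (sortw i d) - f d.
Proof.
pose t (i : 'I_n) (v : F^o) : F^o := 0.
have t_linear i : linear (t i) by move=> a v w; rewrite scaler0 addr0.
pose T i : lendo nzW := Lendo nzW (@indT_linear _ _ n _ _ t_linear i).
have [|||rho rhoT] := @AKS_hecke_rep F n r u (lendo nzW) T.
- move=> i; apply: lendoP => f; rewrite lendo_mulE lendo_addE lendoD /=.
  by rewrite indT_quad ?addNr // => j v; rewrite oppr0.
- by move=> i j ij; apply: lendoP => f; apply: indT_braid => // k v;
  rewrite oppr0.
- by move=> i j ij; apply: lendoP => f; apply: indT_comm.
exists rho => i f d; rewrite /natT /sortw; case: insubP => [k _ _|_] /=.
  by rewrite rhoT ffunE add0r; case: ifP; rewrite ?subrr.
by rewrite raddf0 subrr ffunE.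
Qed.

Lemma eta_exists (I : composition n) : exists eta : AKS n u, is_eta I eta.
Proof.
pose b i := oapp (fun k : 'I_n => k \in descents I) false (insub i).
exists (zprod (natT (genT u)) (zstair b n)).
have rel := @AKS_relations F n r u.
have quad := T_quad rel.
have braid (i j : 'I_n) (ij : j = i.+1 :> nat) := rel _ _ (rel_braid u (genT u)
  (genxi u) ij).
have comm (i j : 'I_n) ij := rel _ _ (rel_comm u (genT u) (genxi u) (i := i) (j
  := j) ij).
have eig (i : 'I_n) := zT_zstair (natT_quad quad) (natT_braid braid) (natT_comm
  comm) b (ltn_ord i).
split=> [S|| i].
- exact: zprod_subalg.
- have nzW : exists f : {ffun colorword n n -> F^o}, f != 0.
    exists [ffun => 1]; apply/negP => /eqP/(congr1 (fun f : {ffun _ -> F^o} =>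
      f (idw n))).
    by rewrite !ffunE => /eqP; rewrite oner_eq0.
  have [rho rhoE] := sort_rep nzW.
  have := @zprod_zstair_neq0 F n nzW (rho \o natT (genT u)) rhoE b.
  by rewrite -zprod_rmorph; apply: contraNneq => ->; rewrite raddf0.
have e := eig i; rewrite /zT natT_ord {1}/b valK [oapp _ _ _]/= in e.
by split=> [D|/negbTE D]; rewrite D in e; exact: e.
Qed.

End EtaExists.

(** * One-dimensional modules *)

Section OneDimensional.
Variables (F : fieldType) (A : algType F).

Lemma scaler_alg_comm (M : lmodType A) (a : A) (k : F) (v : M) :
  a *: (k%:A *: v) = k%:A *: (a *: v).
Proof. by rewrite !scalerA comm_alg. Qed.

Lemma scaler_algM (M : lmodType A) (k l : F) (v : M) :
  k%:A *: (l%:A *: v) = (k * l)%:A *: v :> M.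
Proof. by rewrite scalerA mulr_algl scalerA. Qed.

Lemma one_dimensional_simple (M : lmodType A) : one_dimensional M ->
  simple_module M.
Proof.
case=> v [g gK Kg]; have v0 : v != 0.
  apply/eqP => v0; have /eqP := gK 1; have := gK 0.
  by rewrite v0 !scaler0 => ->; rewrite eq_sym oner_eq0.
split=> [|U [_ Ulin]]; first by exists v.
have [[x xU x0]|nU] := pselect (exists2 x, x \in U & x != 0); last first.
  left=> x xU; apply: contrapT => /eqP x0; apply: nU.
  by exists x.
have U0 : 0 \in U by rewrite -(addNr x) -scaleN1r Ulin.
right=> y; have gx0 : g x != 0.
  by apply: contraNneq x0 => gx0; rewrite -(Kg x) gx0 scale0r scale0r.
have -> : y = (g y / g x)%:A *: x.
  by rewrite -{2}(Kg x) scaler_algM divfK // Kg.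
by rewrite -[_ *: _]addr0 Ulin.
Qed.

(** The last hypothesis says that both modules have the same character, so sending each multiple of
    [v] to the same multiple of [w] is linear over [A]. *)
Lemma one_dimensional_iso (M N : lmodType A) (v : M) (w : N) :
    bijective (fun k : F => (k%:A : A) *: v) ->
    bijective (fun k : F => (k%:A : A) *: w) ->
    (forall a : A, exists k : F, a *: v = k%:A *: v /\ a *: w = k%:A *: w) ->
  module_iso M N.
Proof.
case=> g gK Kg [h hK Kh] vw.
pose f m : N := (g m)%:A *: w.
have f_lin : linear f.
  move=> a x y; have [k [av aw]] := vw a; rewrite /f.
  have -> : g (a *: x + y) = g x * k + g y.
    rewrite -[RHS]gK scalerDl scalerDl -scaler_algM -av -scaler_alg_comm.
    by rewrite !Kg.
  by rewrite scalerDl scalerDl -scaler_algM -aw -scaler_alg_comm.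
exists (HB.pack f (GRing.isLinear.Build A M N *:%R f f_lin) : {linear M -> N}).
exists (fun m => (h m)%:A *: v) => m /=; rewrite /f.
  by rewrite hK Kg.
by rewrite gK Kh.
Qed.

(** * Left ideals generated by a joint eigenvector *)

Section PrincipalIdeal.
Variable w : A.
Hypothesis w_neq0 : w != 0.
Hypothesis w_eigen : forall a : A, exists k : F, a * w = k *: w.

Fact princ_gen_subproof : (w : A^o) \in princ w.
Proof. by apply/asboolP; exists 1; rewrite mul1r. Qed.
Definition princ_gen : princ_ideal w := PrincIdeal princ_gen_subproof.

Lemma princ_scale_eigen (x : A) (k : F) (v : princ_ideal w) :
  x * w = k *: w -> x *: v = k%:A *: v.
Proof.
move=> xw; apply/val_inj; rewrite !linearZ /=.
have /asboolP[a ->] := princ_valP v; have [l ->] := w_eigen a.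
by rewrite -[x *: _]/(x * _) -[_%:A *: _]/(_ * _) -scalerAr xw mulr_algl
  !scalerA mulrC.
Qed.

Lemma princ_gen_bij : bijective (fun k : F => (k%:A : A) *: princ_gen).
Proof.
have val_gen k : princ_val (k%:A *: princ_gen) = k *: w.
  by rewrite -[LHS]/(val (k%:A *: princ_gen)) linearZ -[LHS]/(k%:A * w)
    mulr_algl.
have inj : injective (fun k : F => (k%:A : A) *: princ_gen).
  move=> k l /(congr1 (@princ_val _ _)); rewrite !val_gen => kl.
  apply/eqP; apply: contraNT w_neq0 => nkl; apply/eqP.
  exact: (eigen_eq0 kl nkl).
have surj (v : princ_ideal w) : exists k : F, k%:A *: princ_gen = v.
  have /asboolP[a va] := princ_valP v; have [k ak] := w_eigen a.
  by exists k; apply/val_inj; rewrite [LHS]val_gen -ak -va.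
have [g gK] := choice surj.
by exists g => // k; apply: inj; rewrite gK.
Qed.

Lemma princ_one_dimensional : one_dimensional (princ_ideal w : lmodType A).
Proof. by exists princ_gen; apply: princ_gen_bij. Qed.

Lemma princ_minimal : minimal_left_ideal (princ w).
Proof.
split; first exact: princ_submod_closed.
  by exists w => //; apply: princ_gen_subproof.
move=> J [J0 Jlin] Jw [x xJ x0] _ /asboolP[b ->].
have /asboolP[a xa] := Jw _ xJ; have [k ak] := w_eigen a.
have k0 : k != 0 by apply: contraNneq x0 => k0; rewrite xa ak k0 scale0r.
have -> : b * w = (k^-1 *: b) *: x + 0.
  by rewrite addr0 xa ak -[RHS]/(_ * _) -scalerAl -scalerAr scalerA mulVf
    ?scale1r.
exact: Jlin.
Qed.

End PrincipalIdeal.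
End OneDimensional.

Lemma freeeval_subalg (F : fieldType) (G : choiceType) (B : algType F)
    (h : G -> B) (S : {pred B}) (x : freealg F G) :
  GRing.subalg_closed S -> (forall g, h g \in S) -> freeeval h x \in S.
Proof.
move=> [S1 Slin Smul] Sh.
have S0 : 0 \in S by rewrite -(addNr (1 : B)) -scaleN1r Slin.
have Smon m : evalmon h m \in S.
  rewrite /evalmon; elim: (fmonom_val m) => [|g s IHs];
    first by rewrite big_nil.
  by rewrite big_cons Smul.
rewrite /freeeval mmapE; apply: (big_rec (fun y => y \in S)) => // m y _ yS.
by rewrite mulr_algl Slin.
Qed.

(** By uniqueness of evaluation, the projection from the free algebra is the evaluation at the
    generators, which stays in any subalgebra containing them. *)
Lemma AKS_generated (F : fieldType) (n r : nat) (u : 'I_r.+1 -> F)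
    (S : {pred AKS n u}) : GRing.subalg_closed S ->
  (forall i, genT u i \in S) -> (forall j, genxi u j \in S) -> forall x, x \in
    S.
Proof.
move=> Salg ST Sxi x.
have [a ->] : exists a, x = AKSproj u a by exact: quotproj_surj.
have -> : AKSproj u a = freeeval (gens_fun (genT u) (genxi u)) a.
  by apply: freeeval_uniq => -[].
by apply: freeeval_subalg => // -[].
Qed.

(** * Cycloribbons in terms of descent sets *)

Section Ribbons.
Variables (n r : nat).
Implicit Types (D : {set 'I_n}) (c : colorword n r) (i : 'I_n).

(** Compositions matter only through their descent sets, so the arguments on modules are made for an
    arbitrary set [D] of positions. *)
Definition ribbon_set D c : Prop := forall i : 'I_n,
  (i \in D -> (c (lo i) >= c (hi i))%N) /\
  (i \notin D -> (c (lo i) <= c (hi i))%N).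

Definition phi_set c D : {set 'I_n} :=
  [set i : 'I_n | (i \in D) && (c (lo i) == c (hi i)) ||
                  (i \notin D) && (c (lo i) != c (hi i))].

Lemma phi_setK c : involutive (phi_set c).
Proof.
by move=> D; apply/setP => i; rewrite !inE; case: (i \in D); case: (_ == _).
Qed.

Lemma descents_phi (I : composition n) c :
  descents (phi I c) = phi_set c (descents I).
Proof. exact: comp_of_descentsK. Qed.

Lemma sumn_take_lt (s : seq nat) k l : all (fun m => 0 < m)%N s ->
  (k < l <= size s)%N -> (sumn (take k s) < sumn (take l s))%N.
Proof.
move=> s0 /andP[kl ls]; have ks := leq_trans kl ls.
rewrite -(subnKC (ltnW kl)) takeD sumn_cat -[ltnLHS]addn0 ltn_add2l.
rewrite (drop_nth 0%N ks) (_ : l - k = (l - k.+1).+1)%N /=; last by lia.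
by rewrite ltn_addr // (allP s0) ?mem_nth.
Qed.

(** The proper partial sums increase strictly, so the descent set determines them as a list;
    together with the total [n.+1] they give back the parts as differences. *)
Lemma descents_inj : injective (@descents n).
Proof.
pose psums (s : seq nat) := [seq sumn (take k s) | k <- iota 1 (size s).-1].
have psums_sorted (s : seq nat) : all (fun m => 0 < m)%N s -> sorted ltn (psums
  s).
  move=> s0; rewrite /psums sorted_map.
  apply: (@sub_in_sorted _ (fun k => k <= size s)%N ltn _ _ _ _
    (iota_ltn_sorted _ _)).
    by move=> k l _ ls kl; apply: sumn_take_lt => //; apply/andP; split.
  by apply/allP => k; rewrite mem_iota /in_mem /=; lia.
move=> [s s_comp] [s' s'_comp] e; apply/val_inj => /=; move: e.
have [/andP[s0 /eqP sn] /andP[s'0 /eqP s'n]] := (s_comp, s'_comp).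
have psums_descents (q : seq nat) (q_comp : is_composition n.+1 q) x :
    (x \in psums q) = [exists i : 'I_n, (i \in descents (exist _ q q_comp)) &&
      (x == i.+1)].
  have /andP[q0 /eqP qn] := q_comp.
  apply/idP/existsP => [xq|[i /andP[iq /eqP->]]]; last by rewrite inE in iq.
  have /mapP[k] := xq; rewrite mem_iota => kq xk.
  have x0 : (0 < x)%N by have := @sumn_take_lt q 0 k q0; rewrite take0 xk;
    apply; lia.
  have xn : (x.-1 < n)%N.
    by rewrite prednK // -ltnS -qn xk -{2}(take_size q) sumn_take_lt //; lia.
  by exists (Ordinal xn); rewrite inE /= prednK // eqxx andbT.
move=> e; have {}e : psums s = psums s'.
  apply: (irr_sorted_eq ltn_trans ltnn); rewrite ?psums_sorted // => x.
  by rewrite (psums_descents _ s_comp) (psums_descents _ s'_comp) e.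
have s_gt0 (q : seq nat) : sumn q = n.+1 -> (0 < size q)%N by case: q.
have ss : size s = size s'.
  have := congr1 size e; rewrite !size_map !size_iota => /(congr1 succn).
  by rewrite !prednK ?s_gt0.
have st k : (k <= size s)%N -> sumn (take k s) = sumn (take k s').
  rewrite leq_eqVlt => /predU1P[->|ks]; first by rewrite {2}ss !take_size sn
    s'n.
  case: k ks => [|k] ks; first by rewrite !take0.
  have := congr1 (nth 0%N ^~ k) e; rewrite !(nth_map 0%N) ?size_iota -?ss;
    try lia.
  by rewrite !nth_iota -?ss; try lia; rewrite add1n.
apply: (@eq_from_nth _ 0%N) => // k ks; have := st _ ks.
rewrite (take_nth 0%N ks) (take_nth 0%N) -?ss // -!cats1 !sumn_cat st 1?ltnW //.
by move/addnI; rewrite /= !addn0.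
Qed.

End Ribbons.

(** * Characters of the algebra *)

Section Characters.
Variables (F : fieldType) (n r : nat) (u : 'I_r.+1 -> F).
Hypothesis u_inj : injective u.
Variables (A : algType F) (T : 'I_n -> A) (xi : 'I_n.+1 -> A).
Hypothesis AKS_rel : forall a b, AKS_relation u T xi a b -> a = b.
Hypothesis A_gen : forall S : {pred A}, GRing.subalg_closed S ->
  (forall i, T i \in S) -> (forall j, xi j \in S) -> forall x, x \in S.

Local Notation L := (@Lprod F n r u A xi).
Implicit Types (D : {set 'I_n}) (c d : colorword n r).

(** The elements acting on [v] and [w] by a common scalar form a subalgebra. With [w := v], a joint
    eigenvector of the generators is one of the whole algebra. *)
Lemma common_character (M N : lmodType A) (v : M) (w : N) :
    (forall i, exists k : F, T i *: v = k%:A *: v /\ T i *: w = k%:A *: w) ->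
    (forall j, exists k : F, xi j *: v = k%:A *: v /\ xi j *: w = k%:A *: w) ->
  forall a : A, exists k : F, a *: v = k%:A *: v /\ a *: w = k%:A *: w.
Proof.
move=> Tvw xivw a.
pose S : {pred A} := fun a =>
  `[< exists k : F, a *: v = k%:A *: v /\ a *: w = k%:A *: w >].
suff /asboolP : a \in S by [].
apply: A_gen => [|i|j]; [|exact/asboolP|exact/asboolP].
split=> [|b x y /asboolP[k [xv xw]] /asboolP[l [yv yw]]|
         x y /asboolP[k [xv xw]] /asboolP[l [yv yw]]]; apply/asboolP.
- by exists 1; rewrite !scale1r.
- exists (b * k + l).
  have bx (P : lmodType A) (p : P) : (b *: x) *: p = b%:A *: (x *: p).
    by rewrite scalerA mulr_algl.
  by rewrite !scalerDl !bx xv xw yv yw !scaler_algM.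
- exists (l * k).
  by rewrite -[(x * y) *: v]scalerA -[(x * y) *: w]scalerA yv yw
    !scaler_alg_comm
    xv xw !scaler_algM.
Qed.

(** In [T_Lprod], a strict fall of letters occurs only at a descent, where [T i * eta = - eta]
    cancels the extra [L (swapw i c) * eta]. A strict rise occurs only at a nondescent, where
    [- (L c * eta)] alone is left. For equal letters [T i] commutes with [L c]. *)
Lemma T_ribbon D c (eta : A) i : ribbon_set D c ->
    (forall i : 'I_n, (i \in D -> - T i * eta = eta) /\
                      (i \notin D -> (1 + T i) * eta = eta)) ->
  T i * (L c * eta) = if i \in phi_set c D then - (L c * eta) else 0.
Proof.
move=> rib etaE; rewrite mulrA (T_Lprod u_inj AKS_rel) !(mulrDl, mulNr) -mulrA
  inE.
have [ge le] := rib i; have [e1 e2] := etaE i.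
have [iD|iD] := boolP (i \in D).
  have Te : T i * eta = - eta by rewrite -[in RHS](e1 iD) mulNr opprK.
  have := ge iD; rewrite Te; case: (ltngtP (c (lo i)) (c (hi i))) => //
    [h|/val_inj h] _.
    by rewrite -val_eqE /= gtn_eqF // mulrN addNr mul0r subr0.
  by rewrite h eqxx swapw_id //= !mul0r addr0 subr0 mulrN.
have Te : T i * eta = 0 by apply: (addrI eta);
  rewrite addr0 -[RHS](e2 iD) mulrDl mul1r.
have := le iD; rewrite Te; case: (ltngtP (c (lo i)) (c (hi i))) => //
  [h|/val_inj h] _.
  by rewrite -val_eqE /= ltn_eqF // mulr0 mul0r !add0r.
by rewrite h eqxx /= mulr0 !mul0r addr0 subr0.
Qed.

Lemma ribbon_eigen D c (eta : A) : ribbon_set D c ->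
    (forall i : 'I_n, (i \in D -> - T i * eta = eta) /\
                      (i \notin D -> (1 + T i) * eta = eta)) ->
  forall a : A, exists k : F, a * (L c * eta) = k *: (L c * eta).
Proof.
move=> rib etaE a.
have [||k [+ _]] := @common_character A^o A^o (L c * eta) (L c * eta) _ _ a.
- move=> i; exists (if i \in phi_set c D then -1 else 0).
  suff E : T i * (L c * eta) = (if i \in phi_set c D then -1 else 0)%:A * (L c
    * eta) by [].
  by rewrite (T_ribbon _ rib etaE) mulr_algl; case: ifP;
    rewrite ?scaleN1r ?scale0r.
- move=> j; exists (u (c j)).
  suff E : xi j * (L c * eta) = (u (c j))%:A * (L c * eta) by [].
  by rewrite mulrA (xi_Lprod AKS_rel) -scalerAl mulr_algl.
by move=> e; exists k; rewrite -[RHS]mulr_algl.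
Qed.

Lemma Lprod_fix (M : lmodType A) (v : M) c :
  (forall j, xi j *: v = (u (c j))%:A *: v) -> L c *: v = v.
Proof.
move=> xiv.
have hv j p : horner_alg (xi j) p *: v = p.[u (c j)]%:A *: v.
  elim/poly_ind: p => [|p a IHp]; first by rewrite raddf0 horner0 !scale0r.
  rewrite rmorphD rmorphM /= horner_algX horner_algC hornerMXaddC !scalerDl.
  by rewrite -scalerA xiv scaler_alg_comm IHp scaler_algM mulrC.
rewrite /Lprod; elim: (index_enum _) => [|j s IHs];
  first by rewrite big_nil scale1r.
by rewrite big_cons -scalerA IHs hv lagrangeP_node // eqxx !scale1r.
Qed.

(** The module is compared with the ideal of any nonzero [w] having the eigenvalues of [T_ribbon]
    and [xi_Lprod]; [L c * eta] will be such an element. *)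
Lemma one_dimensional_classification (M : lmodType A) : one_dimensional M ->
  exists D c, ribbon_set D c /\
    forall w : A, w != 0 ->
      (forall i, T i * w = if i \in phi_set c D then - w else 0) ->
      (forall j, xi j * w = u (c j) *: w) ->
    module_iso M (princ_ideal w).
Proof.
case=> v v_bij; have [g gK Kg] := v_bij.
have v0 : v != 0.
  apply/eqP => v0; have /eqP := gK 1; have := gK 0.
  by rewrite v0 !scaler0 => ->; rewrite eq_sym oner_eq0.
have alg_eq0 (k : F) : k%:A *: v = 0 -> k = 0.
  by move=> kv; rewrite -(gK k) kv -(gK 0) scale0r scale0r.
(* The eigenvalue of [xi j] is a root of the product of the ['X - (u k)%:P], hence a node; its index
   is the color [c j]. *)
have [c cE] : exists c : colorword n r, forall j, xi j *: v = (u (c j))%:A *: v.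
  suff /choice[c cE] : forall j, exists k : 'I_r.+1, xi j *: v = (u k)%:A *: v.
    by exists [ffun j => c j] => j; rewrite ffunE.
  move=> j; pose x := g (xi j *: v); have xv : xi j *: v = x%:A *: v by rewrite
    Kg.
  have hv p : horner_alg (xi j) p *: v = p.[x]%:A *: v.
    elim/poly_ind: p => [|p a IHp]; first by rewrite raddf0 horner0 !scale0r.
    rewrite rmorphD rmorphM /= horner_algX horner_algC hornerMXaddC !scalerDl.
    by rewrite -scalerA xv scaler_alg_comm IHp scaler_algM mulrC.
  have := hv (\prod_(k < r.+1) ('X - (u k)%:P)).
  rewrite -prod_horner_alg (AKS_rel (rel_min u T xi j)) scale0r =>
    /esym/alg_eq0/eqP.
  rewrite horner_prod => /prodf_eq0[k _]; rewrite hornerXsubC subr_eq0 => /eqP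
    xk.
  by exists k; rewrite -xk.
(* An eigenvalue [k] of [T i] satisfies [k * k = - k], so it is 0 or -1. *)
pose J := [set i : 'I_n | `[< T i *: v = - v >]].
have TJ i : T i *: v = if i \in J then - v else 0.
  rewrite inE; case: asboolP => // nT.
  pose k := g (T i *: v); have kv : T i *: v = k%:A *: v by rewrite Kg.
  have : T i *: (T i *: v) = - (T i *: v) by rewrite scalerA (T_quad AKS_rel)
    scaleNr.
  rewrite {1}kv scaler_alg_comm kv scaler_algM => /eqP.
  rewrite -addr_eq0 -scalerDl -scalerDl => /eqP/alg_eq0/eqP.
  rewrite -{3}[k]mulr1 -mulrDr mulf_eq0 addr_eq0 => /orP[/eqP->|/eqP k1].
    by rewrite !scale0r.
  by case: nT; rewrite kv k1 scaleN1r scaleNr scale1r.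
have Lv := Lprod_fix cE.
(* [L c] fixes [v], so [L c * T i * L c] acts on [v] by the eigenvalue of [T i], which
   [Lprod_T_diag] computes for distinct letters. *)
have TL i : c (lo i) != c (hi i) -> (i \in J) = (c (lo i) < c (hi i))%N.
  move=> cc; have : (L c * T i * L c) *: v = if i \in J then - v else 0.
    by rewrite -!scalerA Lv TJ; case: ifP => _; rewrite ?scaler0 ?scalerN ?Lv.
  rewrite (Lprod_T_diag u_inj AKS_rel cc).
  case: ifP => _; rewrite ?scaleNr ?Lv ?scale0r; case: (i \in J) => //.
    by move/eqP; rewrite oppr_eq0 (negbTE v0).
  by move/esym/eqP; rewrite oppr_eq0 (negbTE v0).
(* By [TL], [J] and [c] form an anticycloribbon; the involution makes it a cycloribbon, and
   [phi_setK] gives [J] back. *)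
exists (phi_set c J), c; split=> [i|w w0 Tw xiw].
  rewrite ![i \in phi_set _ _]inE; have [->|cc] := eqVneq (c (lo i)) (c (hi
    i)); first by split.
  by rewrite (TL _ cc) andbF andbT /=; case: ltngtP.
have w_eigen (N : lmodType A) (x : N) :
    (forall i, T i *: x = if i \in J then - x else 0) ->
    (forall j, xi j *: x = (u (c j))%:A *: x) ->
  forall a : A, exists k : F, a *: v = k%:A *: v /\ a *: x = k%:A *: x.
  move=> Tx xix; apply: common_character => [i|j]; last by exists (u (c j)).
  exists (if i \in J then -1 else 0); rewrite Tx TJ.
  by case: ifP => _; rewrite ?scaleN1r ?scaleNr ?scale1r ?scale0r.
rewrite phi_setK in Tw.
have wA (a : A) : exists k : F, a * w = k *: w.
  have [||k [_ e]] := w_eigen A^o w _ _ a; first exact: Tw.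
    by move=> j; rewrite -[RHS]/(_ * w) mulr_algl -xiw.
  by exists k; rewrite -[RHS]mulr_algl.
apply: (one_dimensional_iso v_bij (princ_gen_bij w0 wA)).
apply: w_eigen => [i|j]; last exact: (princ_scale_eigen wA).
have := Tw i; case: ifP => _ e.
  by rewrite (princ_scale_eigen wA (k := -1)) ?scaleN1r // scaleN1r.
by rewrite (princ_scale_eigen wA (k := 0)) ?scale0r // scale0r.
Qed.

Section RibbonModules.
Variables (D : {set 'I_n}) (c : colorword n r) (eta : A).
Hypothesis rib : ribbon_set D c.
Hypothesis etaE : forall i : 'I_n, (i \in D -> - T i * eta = eta) /\
                                   (i \notin D -> (1 + T i) * eta = eta).

Lemma ribbon_Lprod d (v : princ_ideal (L c * eta)) :
  L d *: v = if d == c then v else 0.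
Proof.
have wA := ribbon_eigen rib etaE.
rewrite (princ_scale_eigen wA (k := (d == c)%:R)); last first.
  rewrite mulrA (Lprod_mul u_inj AKS_rel).
  by case: eqP => [->|_]; rewrite ?scale1r ?mul0r ?scale0r.
by case: eqP => _; rewrite ?scale1r ?scale0r.
Qed.

Lemma ribbon_T i (v : princ_ideal (L c * eta)) :
  T i *: v = if i \in phi_set c D then - v else 0.
Proof.
have wA := ribbon_eigen rib etaE.
rewrite (princ_scale_eigen wA (k := if i \in phi_set c D then -1 else 0)).
  by case: ifP => _; rewrite ?scaleN1r ?scale0r // scaleN1r.
by rewrite (T_ribbon _ rib etaE); case: ifP => _; rewrite ?scaleN1r ?scale0r.
Qed.

End RibbonModules.

(** [L c] acts by 1 on the first module, hence on the second, which forces [c = c']. The eigenvalues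
    of the [T i] then give equal images of [D] and [D'] under the involution [phi_set c]. *)
Lemma ribbon_iso D D' c c' (eta eta' : A) :
    ribbon_set D c -> ribbon_set D' c' ->
    (forall i : 'I_n, (i \in D -> - T i * eta = eta) /\
                      (i \notin D -> (1 + T i) * eta = eta)) ->
    (forall i : 'I_n, (i \in D' -> - T i * eta' = eta') /\
                      (i \notin D' -> (1 + T i) * eta' = eta')) ->
    L c * eta != 0 ->
    module_iso (princ_ideal (L c * eta)) (princ_ideal (L c' * eta')) ->
  D = D' /\ c = c'.
Proof.
move=> rib rib' etaE etaE' w0 [f /bij_inj f_inj].
pose v := princ_gen (L c * eta).
have fv0 : f v != 0.
  apply: contraNneq w0 => fv0; have /(congr1 val) /= -> // : v = 0.
  by apply: f_inj; rewrite fv0 raddf0.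
have cc' : c = c'.
  have : f (L c *: v) = L c *: f v by rewrite linearZ.
  rewrite (ribbon_Lprod rib etaE) (ribbon_Lprod rib' etaE') eqxx.
  by case: eqP => // _ /eqP; rewrite (negbTE fv0).
split=> //; apply: (can_inj (phi_setK c)); apply/setP => i.
rewrite [in RHS]cc'.
have : f (T i *: v) = T i *: f v by rewrite linearZ.
rewrite (ribbon_T rib etaE) (ribbon_T rib' etaE').
case: (i \in phi_set c D); case: (i \in phi_set c' D') => //.
  by rewrite raddfN => /eqP; rewrite oppr_eq0 (negbTE fv0).
by rewrite raddf0 => /esym/eqP; rewrite oppr_eq0 (negbTE fv0).
Qed.

End Characters.

(** * The simple modules of cycloribbons and their classification *)

Theorem theorem5p1 (R : realType) (n r : nat) (u : 'I_r.+1 -> R[i])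
    (u_inj : injective u) :
  [/\ (forall (I : composition n) (c : colorword n r) (eta : AKS n u),
         cycloribbon I c -> is_eta I eta ->
         [/\ simple_module (Smod c eta),
             minimal_left_ideal (princ (eta_ribbon c eta)),
             one_dimensional (Smod c eta),
             (forall (d : colorword n r) (v : Smod c eta),
                Lword u d *: v = if d == c then v else 0) &
             (forall (i : 'I_n) (v : Smod c eta),
                genT u i *: v = if i \in descents (phi I c) then - v else 0)]),
      (forall (I I' : composition n) (c c' : colorword n r)
              (eta eta' : AKS n u),
         cycloribbon I c -> cycloribbon I' c' ->
         is_eta I eta -> is_eta I' eta' ->
         (I, c) <> (I', c') ->
         ~ module_iso (Smod c eta) (Smod c' eta')) &
      (forall M : lmodType (AKS n u), one_dimensional M ->
         exists (I : composition n) (c : colorword n r),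
           [/\ cycloribbon I c,
               (exists eta : AKS n u, is_eta I eta) &
               (forall eta : AKS n u, is_eta I eta ->
                  module_iso M (Smod c eta))])].
Proof.
have rel := @AKS_relations _ n r u.
have gen := @AKS_generated _ n r u.
(* Since [eta] lies in the 0-Hecke algebra, no [Lword u c] can kill it. *)
have w0 (I : composition n) c eta : is_eta I eta -> Lword u c * eta != 0.
  case=> eta_hecke eta0 _; apply: contraNneq eta0 => /(Lword_hecke0_eq0 u_inj eta_hecke) ->.
  by rewrite eqxx.
split=> [I c eta rib etaP|I I' c c' eta eta' rib rib' etaP etaP' II' iso|M M1].
- have [_ _ etaE] := etaP.
  have wA := ribbon_eigen u_inj rel gen rib etaE.
  split.
  + exact: (one_dimensional_simple (princ_one_dimensional (w0 I c eta etaP) wA)).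
  + exact: (princ_minimal (w0 I c eta etaP) wA).
  + exact: (princ_one_dimensional (w0 I c eta etaP) wA).
  + exact: (ribbon_Lprod u_inj rel gen rib etaE).
  + by move=> i v; rewrite descents_phi; apply: (ribbon_T u_inj rel gen rib etaE).
- have [_ _ etaE] := etaP; have [_ _ etaE'] := etaP'.
  have [DD cc] := ribbon_iso u_inj rel gen rib rib' etaE etaE' (w0 _ c _ etaP) iso.
  by apply: II'; rewrite (descents_inj DD) cc.
have [D [c [rib class]]] := one_dimensional_classification u_inj rel gen M1.
exists (comp_of_descents D), c; split.
- by move=> i; rewrite comp_of_descentsK; apply: rib.
- exact: eta_exists.
move=> eta etaP; have [_ _ etaE] := etaP; rewrite comp_of_descentsK in etaE.
apply: class.
- exact: (w0 _ c _ etaP).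
- by move=> i; apply: (T_ribbon u_inj rel _ rib etaE).
- by move=> j; rewrite mulrA (xi_Lprod rel) -scalerAl.
Qed.
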